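(* Assume that $\lim_{p\searrow c} F(p)/(p-c)^{\nu+1}=\kappa$ for some constants $-1<\nu<0$ and $0<\kappa<\infty$. Let $\varepsilon>0$. If $0<b<\infty$ is large enough, then for all large enough $t$, $$P\{X_t\le bt^{(1+\nu)/2}\}\ge 1-\varepsilon.$$ If $0<a<\infty$ is small enough, then for all large enough $t$, $$P\{X_t\ge at^{(1+\nu)/(3+\nu)}\}\ge 1-\varepsilon.$$ (Here the thresholds for $b$ and $a$ may depend on $\varepsilon$, and the threshold for $t$ may depend on $\varepsilon$ and on $b$, respectively $a$.)
   Context: Rates: $F$ is a probability distribution function supported on $(c,1]$, where $c>0$ is the left endpoint of the support: $F(p)=0$ for $p<c$, $F(c)=0$, $F(p)>0$ for $p>c$, $F(1)=1$. The rates $\{p_i\}_{i\le 0}$ are i.i.d. with distribution $F$. Process: particles are labeled by nonpositive integers, with positions $\cdots<\xi_{-2}(t)<\xi_{-1}(t)<\xi_0(t)$ in $\mathbf{Z}$ and initial positions $\xi_i(0)=i$ for $i\le 0$. Given the rates, each particle $i$ has an independent Poisson clock of rate $p_i$; whenever it rings, $\xi_i$ moves one step to the right provided the next site to the right is vacant (exclusion rule). $X_t=0\vee\sup\{k\ge 1:\xi_{-k+1}(t)>ct\}$ is the number of particles strictly beyond $ct$ at time $t$. $P$ is the annealed probability measure, under which both the rates and the Poisson clocks are random. *)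

(* Defs.v *)
From HB Require Import structures.
From mathcomp Require Export all_boot all_order all_algebra.
From mathcomp Require Export all_classical all_reals all_analysis.

Set Implicit Arguments.
Unset Strict Implicit.
Unset Printing Implicit Defensive.

Import Order.TTheory GRing.Theory Num.Theory.
Import numFieldNormedType.Exports.

Local Open Scope classical_set_scope.
Local Open Scope ring_scope.

(* MathComp-Analysis.  Throughout, the index k : nat stands for the particle
   with label -k, so that particle k.+1 sits behind particle k. *)

Section Rates.
Context {d : measure_display} {T : measurableType d} {R : realType}
  {P : probability T R}.

Definition mutually_independent (X : nat -> {RV P >-> R}) : Prop :=
  forall (s : seq nat) (B : nat -> set R), uniq s ->
    (forall k, measurable (B k)) ->
    P (\bigcap_(k in [set` s]) (X k @^-1` B k)) =
      (\prod_(k <- s) P (X k @^-1` B k))%E.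

Definition iid_with_df (F : R -> R) (X : nat -> {RV P >-> R}) : Prop :=
  mutually_independent X /\ forall k x, cdf (X k) x = (F x)%:E.

Definition sigma_rates (rate : nat -> {RV P >-> R}) : set (set T) :=
  <<s \bigcup_k preimage_set_system setT (rate k) measurable >>.

(* [clock k t w] is the number of rings of the clock of particle k during
   [0, t]; only times t >= 0 matter. [clocks_law] says that, conditionally on
   the sigma-algebra of the rates, the clocks are independent, with independent
   increments, and that an increment over a time span D has the Poisson law of
   parameter [rate k * D].  The times are strictly increasing because
   [poisson_pmf] is a probability mass function only at positive parameters. *)
Record poisson_clocks (rate : nat -> {RV P >-> R})
    (clock : nat -> R -> {RV P >-> nat}) : Prop := {
  clocks_0 : forall k w, clock k 0 w = 0%N ;
  clocks_nondecreasing : forall k w s t, 0 <= s -> s <= t ->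
    (clock k s w <= clock k t w)%N ;
  clocks_right_continuous : forall k w t, 0 <= t ->
    \forall s \near t^'+, clock k s w = clock k t w ;
  clocks_law : forall (A : set T) (s : seq nat) (J : nat) (tm : nat -> R)
      (n : nat -> nat -> nat),
    sigma_rates rate A -> uniq s -> 0 <= tm 0%N ->
    (forall j, (j < J)%N -> tm j < tm j.+1) ->
    P (A `&` [set w | forall k j, k \in s -> (j < J)%N ->
                clock k (tm j.+1) w = (clock k (tm j) w + n k j)%N]) =
    (\int[P]_(w in A) (\prod_(k <- s) \prod_(j < J)
        poisson_pmf (rate k w * (tm j.+1 - tm j)) (n k j))%:E)%E
}.

End Rates.

Section Process.
Context {R : realType}.

(* Time of the n-th ring, n >= 1, of a clock with counting path N. *)
Definition ring_time (N : R -> nat) (n : nat) : R :=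
  inf [set s : R | 0 <= s /\ (n <= N s)%N].

(* Position, after n rings of its clock, of a particle started at x0, when
   [ahead] is the trajectory of the next particle to its right.  Since the
   particles stay ordered, the target site is vacant as soon as it is not
   occupied by that particle.  Almost surely no two clocks ring simultaneously,
   so reading [ahead] at the ring time or just before it is the same. *)
Fixpoint position_after (ahead : R -> int) (ring : nat -> R) (x0 : int)
    (n : nat) : int :=
  if n is m.+1 then
    let y := position_after ahead ring x0 m in
    if y + 1 != ahead (ring n) then y + 1 else y
  else x0.

(* [xi N k t] is the position at time t of the particle with label -k, when the
   clocks have the counting paths N. *)
Fixpoint xi (N : nat -> R -> nat) (k : nat) (t : R) : int :=
  if k is j.+1 then
    position_after (xi N j) (ring_time (N j.+1)) (- (j.+1)%:Z) (N j.+1 t)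
  else (N 0%N t)%:Z.

(* The particle with label -k+1 has index k.-1.  The value +oo (when infinitely
   many particles are beyond c * t) and the supremum -oo of the empty set are
   the reason for working in \bar R. *)
Definition beyond (c : R) (N : nat -> R -> nat) (t : R) : \bar R :=
  maxe 0%E (ereal_sup [set k%:R%:E | k in
    [set k : nat | (1 <= k)%N /\ c * t < (xi N k.-1 t)%:~R]]).

End Process.

(* Main.v *)
(* Upper bound: the particles stay ordered, so at most k of them are beyond ct
   as soon as the clock of the particle k rings at most ct times before t.  A
   particle whose rate lies in (c, c + t^(-1/2)] does so with a probability
   bounded away from 0, and about kappa b particles out of b t^((1+nu)/2)
   have such a rate.

   Lower bound: let eta = t^(-1/(3+nu)) and n ~ a t^((1+nu)/(3+nu)) = a eta^2 t.
   With high probability all n rates exceed c + eta.  Cut [0, t] into J cells and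
   let every particle move at most once per cell, into a site that was free at
   the beginning of the cell, behind a virtual leader moving as a Bernoulli walk
   of speed v = c + eta/2, with arbitrary nonnegative initial gaps: this lags
   behind the original system.  The gaps are then discrete-time queues in series;
   averaging over their product-form invariant law, Burke's theorem says that
   the last particle moves as a Bernoulli walk of speed v.  The initial gaps add
   up to O(n / eta) = O(a eta t), so that it is beyond ct at time t. *)

Require Import Defs.
From mathcomp Require Import all_boot all_order all_algebra.
From mathcomp Require Import all_classical all_reals all_analysis.
From mathcomp Require Import measurable_realfun.
From mathcomp Require Import zify ring lra.
Import Order.TTheory GRing.Theory Num.Theory.
Import numFieldNormedType.Exports.
Set Implicit Arguments.
Unset Strict Implicit.
Unset Printing Implicit Defensive.

Local Open Scope classical_set_scope.
Local Open Scope ring_scope.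

(** The exponent of eta balances two losses: among n particles about n kappa eta^(nu+1) have a rate
    in (c, c + eta], and the gaps consume about n / eta of the gain eta t. For n = a eta^2 t the
    second is a small fraction of the gain, and the first is of order a exactly when eta^(nu+1) = 1
    / (eta^2 t). In the upper bound, eta = t^(-1/2) is instead the scale at which eta t matches the
    Poisson fluctuation sqrt t. The true system starts packed, far from equilibrium. No coupling
    with the stationary one is built: leader and gaps are not random variables on [T]. The
    probability of being late is bounded, for each fixed choice of gaps and leader path, by that of
    an event about Bernoulli services; as the left side does not depend on this choice, the bound
    may be averaged over any law, here the invariant one. All these averages are finite sums, queue
    lengths being cut off at [M]; the cutoff turns Burke's identity into an inequality, in the
    useful direction, and [M] tends to infinity only at the end. *)

Definition counting_path {R : realType} (N : R -> nat) : Prop :=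
  N 0 = 0%N /\ forall s t, 0 <= s -> s <= t -> (N s <= N t)%N.

(** * Deterministic properties of the particle paths *)

Section PathwiseComparison.
Context {R : realType}.
Implicit Types (N : R -> nat) (M : nat -> R -> nat) (t s r : R).

Lemma ring_time_ge0 N n : 0 <= ring_time N n.
Proof.
rewrite /ring_time; set S := [set _ | _].
have [->|/set0P ne] := eqVneq S set0; first by rewrite inf0.
by apply: lb_le_inf => // s [].
Qed.

Lemma ring_time_le N n s : 0 <= s -> (n <= N s)%N -> ring_time N n <= s.
Proof. by move=> s0 ns; apply: ge_inf => //; exists 0 => r []. Qed.

(** A time [t] with at least [n] rings has to be supplied because the infimum of the empty set is 0,
    which would make the ring time too early. *)
Lemma ring_time_ge N n s t : counting_path N -> 0 <= s -> (N s < n)%N ->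
  0 <= t -> (n <= N t)%N -> s <= ring_time N n.
Proof.
move=> [_ Nnd] s0 Nsn t0 nt; apply: lb_le_inf; first by exists t.
move=> r [r0 nr]; rewrite leNgt; apply/negP => rs.
by have := Nnd _ _ r0 (ltW rs); lia.
Qed.

Lemma ring_time_homo N m n t : counting_path N -> (m <= n)%N -> 0 <= t ->
  (n <= N t)%N -> ring_time N m <= ring_time N n.
Proof.
move=> cN mn t0 nt; apply: lb_le_inf; first by exists t.
by move=> r [r0 nr]; apply: ring_time_le => //; lia.
Qed.

Lemma position_afterS ahead (ring : nat -> R) x0 n :
  position_after ahead ring x0 n.+1 =
  if position_after ahead ring x0 n + 1 != ahead (ring n.+1)
  then position_after ahead ring x0 n + 1 else position_after ahead ring x0 n.
Proof. by []. Qed.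

Lemma position_after_homo ahead (ring : nat -> R) x0 m n : (m <= n)%N ->
  position_after ahead ring x0 m <= position_after ahead ring x0 n.
Proof.
elim: n => [|n IH]; first by rewrite leqn0 => /eqP ->.
rewrite leq_eqVlt => /predU1P[->//|]; rewrite ltnS => /IH /le_trans; apply.
by rewrite /=; case: ifP => // _; rewrite lerDl.
Qed.

Lemma position_after_le ahead (ring : nat -> R) x0 n :
  position_after ahead ring x0 n <= x0 + n%:Z.
Proof.
elim: n => [|n IH] /=; first by rewrite addr0.
by case: ifP => _; lia.
Qed.

Lemma xi_nondecreasing M k s t : (forall k, counting_path (M k)) ->
  0 <= s -> s <= t -> xi M k s <= xi M k t.
Proof.
move=> cM s0 st; case: k => [|k] /=.
  by rewrite lez_nat; apply: (cM 0%N).2.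
by apply: position_after_homo; apply: (cM _).2.
Qed.

Lemma xi_ge M k t : - k%:Z <= xi M k t.
Proof.
by case: k => [|k] //=; apply: (position_after_homo _ _ _ (leq0n _)).
Qed.

Lemma xi_le M k t : xi M k t <= (M k t)%:Z.
Proof.
case: k => [//|k] /=; apply: le_trans (position_after_le _ _ _ _) _.
by lia.
Qed.

Lemma xi_exclusion M k t : (forall k, counting_path (M k)) -> 0 <= t ->
  xi M k.+1 t < xi M k t.
Proof.
move=> cM t0 /=.
set r := ring_time (M k.+1); set pos := position_after (xi M k) r (- k.+1%:Z).
(* The order is checked at the ring times only: between two rings the particle stands still and the
   one ahead can only move right. At [n = 0] the initial positions suffice. *)
have pos_lt n : (n <= M k.+1 t)%N -> pos n < xi M k (r n).
  elim: n => [_|n IH nt] /=; first by apply: lt_le_trans (xi_ge _ _ _); rewrite /pos /=; lia.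
  have : pos n < xi M k (r n.+1).
    apply: lt_le_trans (IH (ltnW nt)) _; apply: xi_nondecreasing => //.
      exact: ring_time_ge0.
    exact: (ring_time_homo (t := t)).
  rewrite {2}/pos position_afterS -/pos.
  by case: eqVneq => /=; lia.
apply: lt_le_trans (pos_lt _ (leqnn _)) _; apply: xi_nondecreasing => //.
  exact: ring_time_ge0.
exact: ring_time_le.
Qed.

Lemma xi_anti M k l t : (forall k, counting_path (M k)) -> 0 <= t ->
  (k <= l)%N -> xi M l t <= xi M k t.
Proof.
move=> cM t0; elim: l => [|l IH]; first by rewrite leqn0 => /eqP ->.
rewrite leq_eqVlt => /predU1P[->//|]; rewrite ltnS => /IH; apply: le_trans.
exact/ltW/xi_exclusion.
Qed.

Lemma beyond_leP (c t : R) M (x : R) : 0 <= x ->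
  (beyond c M t <= x%:E)%E <->
  forall k, (xi M k t)%:~R <= c * t \/ k.+1%:R <= x.
Proof.
move=> x0; rewrite /beyond ge_max lee_fin x0 /=; split.
  move=> /ereal_supP H k; have [?|lt_ct] := leP (xi M k t)%:~R (c * t); first by left.
  by right; rewrite -lee_fin; apply: H; exists k.+1.
move=> H; apply/ereal_supP => _ [m [m1 lt_ct] <-].
case: m m1 lt_ct => [//|k] _ /= lt_ct; rewrite lee_fin.
by case: (H k) => [|//]; rewrite leNgt lt_ct.
Qed.

Lemma le_beyond (c t : R) M (k : nat) (x : R) :
  c * t < (xi M k t)%:~R -> x <= k.+1%:R -> (x%:E <= beyond c M t)%E.
Proof.
move=> ct xk; rewrite /beyond le_max; apply/orP; right.
by apply: le_ereal_sup_tmp; exists (k.+1%:R%:E) => //; exists k.+1.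
Qed.

(* A discrete-time lower bound: in the j-th time cell [y] moves by at most one,
   only if the clock rings in that cell and the target site was free, as seen
   from a lower bound [lead] of the next particle, at the beginning of the cell. *)
Lemma xi_ge_discrete M k (y lead : nat -> int) (tau : R) :
  (forall k, counting_path (M k)) -> 0 <= tau ->
  (forall l, k = l.+1 -> forall j, lead j <= xi M l (j%:R * tau)) ->
  y 0%N <= - k%:Z ->
  (forall j, y j.+1 = y j \/
    [/\ y j.+1 = y j + 1, (M k (j%:R * tau)%R < M k (j.+1%:R * tau)%R)%N
      & y j + 1 < lead j]) ->
  forall j, y j <= xi M k (j%:R * tau).
Proof.
move=> cM tau0 leadle y0 ystep.
have jt0 j : 0 <= j%:R * tau by rewrite mulr_ge0.
have jtS j : j%:R * tau <= j.+1%:R * tau by rewrite ler_wpM2r// ler_nat.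
elim => [|j IHj]; first exact: le_trans y0 (xi_ge _ _ _).
have xnd := xi_nondecreasing k cM (jt0 j) (jtS j).
case: (ystep j) => [->|[-> ring free]]; first exact: le_trans IHj xnd.
case: k => [|k] in leadle y0 ystep IHj xnd ring free *.
  by move: ring IHj => /=; lia.
(* A particle strictly ahead of [y j] dominates [y j + 1] without moving. Otherwise the two agree,
   and the first ring of the cell, number [m.+1], suffices: by then the particle ahead has reached
   at least [lead j], so the target site is vacant. *)
have [lt_y|le_y] := ltP (y j) (xi M k.+1 (j%:R * tau)); first by lia.
have {le_y} eq_y : xi M k.+1 (j%:R * tau) = y j by lia.
pose m := M k.+1 (j%:R * tau).
apply: le_trans (position_after_homo (m := m.+1) _ _ _ ring).
rewrite position_afterS -[position_after _ _ _ m]/(xi M k.+1 (j%:R * tau)) eq_y.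
rewrite ifT//; have : lead j <= xi M k (ring_time (M k.+1) m.+1).
  apply: le_trans (leadle k erefl j) _; apply: xi_nondecreasing => //.
  exact: ring_time_ge ring.
move=> ahead; apply/eqP => eq_a.
have {}eq_a : y j + 1 = xi M k (ring_time (M k.+1) m.+1) by [].
by move: free ahead; rewrite -eq_a; lia.
Qed.

End PathwiseComparison.

(** * Measurability of the particle positions *)

Section Measurability.
Context {d : measure_display} {T : measurableType d} {R : realType}.
Implicit Types (N : R -> T -> nat) (X : R -> T -> int) (s t : R).

Definition measurable_levels {U} (f : T -> U) : Prop :=
  forall u, measurable [set w | f w = u].

Lemma measurable_ring_time_lt N n s :
  (forall t, 0 <= t -> measurable_levels (N t)) ->
  (forall w, counting_path (N ^~ w)) ->
  measurable [set w | ring_time (N ^~ w) n < s].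
Proof.
move=> mN cN.
have mNge t : 0 <= t -> measurable [set w | (n <= N t w)%N].
  move=> t0; rewrite (_ : [set _ | _] = \bigcup_(m in [set m | (n <= m)%N]) [set w | N t w = m]).
    by apply: bigcup_measurable => m _; exact: mN.
  by apply/seteqP; split=> [w nN|w [m /= nm ->//]]; exists (N t w).
have [s0|s0] := leP s 0.
  rewrite (_ : [set _ | _] = set0)//; apply/seteqP; split => // w /=.
  by move=> /lt_le_trans /(_ s0); rewrite ltNge ring_time_ge0.
(* A clock that never reaches [n] has ring time 0, the infimum of the empty set, hence below
   [s > 0]; otherwise monotonicity provides a rational witness. *)
rewrite (_ : [set _ | _] = ~` (\bigcup_m [set w | (n <= N m%:R w)%N]) `|`
  \bigcup_q (if (0 <= ratr q :> R) && (ratr q < s) then [set w | (n <= N (ratr q) w)%N] else set0)).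
  apply: measurableU.
    by apply: measurableC; apply: bigcupT_measurable => m; exact: mNge.
  apply: bigcupT_measurable_rat => q; case: ifP => // /andP[q0 _]; exact: mNge.
apply/seteqP; split => w /=.
  move=> lt_s; have [[r r0 nr]|noring] := pselect (exists2 r, 0 <= r & (n <= N r w)%N); last first.
    by left=> -[m _ /= nm]; apply: noring; exists m%:R.
  right; have [|r' /= [r'0 nr'] r's] := @inf_lt _ [set r : R | 0 <= r /\ (n <= N r w)%N] s _ lt_s.
    by exists r.
  have [q] := rat_in_itvoo r's; rewrite in_itv/= => /andP[r'q qs].
  exists q => //; rewrite qs (le_trans r'0 (ltW r'q))/=.
  by apply: leq_trans nr' _; apply: (cN w).2 => //; exact: ltW.
move=> [noring|[q _]].
  rewrite /ring_time (_ : [set _ | _] = set0) ?inf0//.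
  apply/seteqP; split => // r /= [r0 nr]; apply: noring.
  exists (Num.truncn r).+1 => //=; apply: leq_trans nr _.
  by apply: (cN w).2 => //; apply/ltW; case/andP: (truncn_itv r0).
case: ifP => // /andP[q0 qs] /= nq; apply: le_lt_trans qs.
exact: (@ring_time_le _ (N ^~ w)).
Qed.

(* Right continuity makes the value at a random time the eventual value along
   the discretisations of that time from above. *)
Lemma measurable_random_time X (r : T -> R) :
  (forall t, 0 <= t -> measurable_levels (X t)) ->
  (forall w t, 0 <= t -> \forall s \near t^'+, X s w = X t w) ->
  (forall w, 0 <= r w) -> (forall s, measurable [set w | r w < s]) ->
  measurable_levels (fun w => X (r w) w).
Proof.
move=> mX rcX r0 mr z.
pose cell i j : R := j%:R / i.+1%:R.
rewrite (_ : [set _ | _] = \bigcup_n \bigcap_(i in [set i | (n <= i)%N])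
  \bigcup_j (([set w | r w < cell i j.+1] `\` [set w | r w < cell i j]) `&`
     [set w | X (cell i j.+1) w = z])).
  apply: bigcupT_measurable => n; apply: bigcap_measurable; first by exists n => /=.
  move=> i _; apply: bigcupT_measurable => j; apply: measurableI.
    by apply: measurableD; exact: mr.
  by apply: mX; rewrite divr_ge0.
have cellP i w : exists2 j, ~ (r w < cell i j) & r w < cell i j.+1.
  have := @truncn_itv R (r w * i.+1%:R); rewrite mulr_ge0// => /(_ isT) /andP[le_r r_lt].
  exists (Num.truncn (r w * i.+1%:R)); first by apply/negP; rewrite -leNgt ler_pdivrMr.
  by rewrite ltr_pdivlMr.
have cvgX w : exists n, forall i j, (n <= i)%N -> ~ (r w < cell i j) ->
    r w < cell i j.+1 -> X (cell i j.+1) w = X (r w) w.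
  have [e /= e0 He] := rcX w _ (r0 w).
  exists (Num.truncn e^-1) => i j ni /negP; rewrite -leNgt => jr rj.
  apply: He => //=; rewrite distrC ger0_norm ?subr_ge0 ?(ltW rj)//.
  have : cell i j.+1 - r w <= i.+1%:R^-1.
    by rewrite lerBlDr /cell -natr1 mulrDl mul1r [leRHS]addrC lerD2r.
  move/le_lt_trans; apply; rewrite invf_plt ?posrE//.
  apply: lt_le_trans (truncnS_gt _) _; by rewrite ler_nat ltnS.
apply/seteqP; split => w /=.
  move=> Xz; have [n Hn] := cvgX w; exists n => // i /= ni.
  by have [j j1 j2] := cellP i w; exists j => //=; split; [split|rewrite (Hn _ _ ni)].
move=> [m _ Hm]; have [n Hn] := cvgX w.
have [|j _ [[/= rj jr] <-]] := Hm (maxn m n); first by rewrite /= leq_maxl.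
by rewrite (Hn (maxn m n))// leq_maxr.
Qed.

(** Both properties go through one induction: particle [k.+1] reads the trajectory of particle [k]
    at its own random ring times, and the measurability of that reading rests on the right
    continuity of the trajectory. *)
Lemma xi_measurable_right_continuous (M : nat -> R -> T -> nat) k :
  (forall k t, 0 <= t -> measurable_levels (M k t)) ->
  (forall k w, counting_path (M k ^~ w)) ->
  (forall k w t, 0 <= t -> \forall s \near t^'+, M k s w = M k t w) ->
  (forall t, 0 <= t -> measurable_levels (fun w => xi (fun j s => M j s w) k t)) /\
  (forall w t, 0 <= t ->
     \forall s \near t^'+, xi (fun j s => M j s w) k s = xi (fun j s => M j s w) k t).
Proof.
move=> mM cM rcM; elim: k => [|k [IHm IHr]].
  split=> [t t0 z|w t t0] /=.
    case: z => n; last by rewrite (_ : [set _ | _] = set0)//; apply/seteqP; split.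
    rewrite (_ : [set _ | _] = [set w | M 0%N t w = n]); first exact: mM.
    by apply/seteqP; split=> w /= => [[]|->].
  by apply: filterS (rcM 0%N w t t0) => s ->.
split=> [t t0|w t t0]; last by apply: filterS (rcM k.+1 w t t0) => s /= ->.
pose ahead w := xi (fun j s => M j s w) k.
pose ring w := ring_time (M k.+1 ^~ w).
have mahead n : measurable_levels (fun w => ahead w (ring w n)).
  apply: (measurable_random_time (X := fun s w => ahead w s)) => //.
    by move=> w; exact: ring_time_ge0.
  by move=> s; apply: measurable_ring_time_lt => //; exact: mM.
have mpos n : measurable_levels (fun w => position_after (ahead w) (ring w) (- k.+1%:Z) n).
  elim: n => [|n IH] z /=.
    have [->|ne] := eqVneq (- k.+1%:Z) z.
      by rewrite (_ : [set _ | _] = setT)//; apply/seteqP; split.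
    by rewrite (_ : [set _ | _] = set0)//; apply/seteqP; split => // w /= /eqP; rewrite (negPf ne).
  pose pos w := position_after (ahead w) (ring w) (- k.+1%:Z) n.
  rewrite (_ : [set _ | _] =
    ([set w | pos w = z - 1] `\` [set w | ahead w (ring w n.+1) = z]) `|`
    ([set w | pos w = z] `&` [set w | ahead w (ring w n.+1) = z + 1])).
    by apply: measurableU; [apply: measurableD|apply: measurableI];
      (exact: IH || exact: mahead).
  apply/seteqP; split => w /=; rewrite -/(pos w).
    by case: eqVneq => [<- <-|/eqP ne <-]; [right|left; rewrite addrK; split=> // /esym].
  move=> [[->]|[-> ->]]; rewrite ?subrK ?eqxx// => ne.
  by case: eqVneq => // /esym.
move=> z; rewrite (_ : [set _ | _] = \bigcup_n ([set w | M k.+1 t w = n] `&`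
   [set w | position_after (ahead w) (ring w) (- k.+1%:Z) n = z])).
  by apply: bigcupT_measurable => n; apply: measurableI; [exact: mM|exact: mpos].
by apply/seteqP; split=> [w /= <-|w [n _ [/= <- <-]]//]; exists (M k.+1 t w).
Qed.

End Measurability.

(** * Product laws on lists of natural numbers *)

Section SeriesExpectation.
Context {R : realType}.
Implicit Types (ps : seq (nat -> R)) (g : seq nat -> bool).
Local Open Scope ereal_scope.

(** Probability of the event [g] for independent coordinates with laws [ps]. The iterated series
    lets every estimate proceed one coordinate at a time, and values in [\bar R] dispense with
    summability. *)
Fixpoint prob_seq ps g : \bar R :=
  if ps is p :: ps' then
    \sum_(m <oo) (p m)%:E * prob_seq ps' (fun v => g (m :: v))
  else (g [::])%:R%:E.

Fixpoint pmf_seq ps (v : seq nat) : R :=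
  match ps, v with p :: ps', m :: v' => (p m * pmf_seq ps' v')%R | _, _ => 1%R end.

Lemma prob_seq_ge0 (I : Type) (l : seq I) (p : I -> nat -> R) g :
  (forall i m, (0 <= p i m)%R) -> 0 <= prob_seq [seq p i | i <- l] g.
Proof.
move=> p0; elim: l g => [|i l IH] g /=; first by rewrite lee_fin; case: (g _).
by apply: nneseries_ge0 => m _ _; rewrite mule_ge0 ?lee_fin.
Qed.

End SeriesExpectation.

Section ProductLaw.
Context {d : measure_display} {T : measurableType d} {R : realType}.
Variables (P : probability T R) (I : Type) (X : I -> T -> nat)
  (p : I -> T -> nat -> R).
Hypothesis mX : forall i, measurable_levels (X i).
Hypothesis p_ge0 : forall i w m, 0 <= p i w m.
Hypothesis mp : forall i m, measurable_fun setT (fun w => p i w m).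

Lemma measurable_map_levels (l : seq I) (g : seq nat -> bool) :
  measurable [set w | g [seq X i w | i <- l]].
Proof.
elim: l g => [|i l IH] g /=.
  by case: (g _); [rewrite (_ : [set _ | _] = setT)|rewrite (_ : [set _ | _] = set0)];
    rewrite // ; apply/seteqP; split.
rewrite (_ : [set _ | _] = \bigcup_m ([set w | X i w = m] `&`
  [set w | g (m :: [seq X j w | j <- l])])).
  apply: bigcupT_measurable => m; apply: measurableI; first exact: mX.
  exact: (IH (fun v => g (m :: v))).
by apply/seteqP; split=> [w gw|w [m _ [/= ->]]//]; exists (X i w).
Qed.

Let ps_ge0 (l : seq I) w (g : seq nat -> bool) :
  (0 <= prob_seq [seq p i w | i <- l] g)%E.
Proof. exact: (prob_seq_ge0 l (p := fun i => p i w)). Qed.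

Lemma measurable_prob_seq (l : seq I) (g : seq nat -> bool) :
  measurable_fun setT (fun w => prob_seq [seq p i w | i <- l] g).
Proof.
elim: l g => [|i l IH] g /=; first exact: measurable_cst.
apply: ge0_emeasurable_sum => m; first by move=> w _ _; rewrite mule_ge0 ?lee_fin.
move=> _; apply: emeasurable_funM; last exact: IH.
by apply/measurable_EFinP; exact: mp.
Qed.

(** Point masses determine the whole law. In the induction [A'] collects the coordinates already
    fixed and [phi] their likelihood, while the domain [A] of the integral stays the same; the sum
    over the next coordinate is exchanged with the integral. *)
Lemma prob_map_levels (A : set T) (l : seq I) : measurable A ->
  forall (A' : set T) (phi : T -> R), measurable A' ->
  measurable_fun setT phi -> (forall w, 0 <= phi w) ->
  (forall v, size v = size l ->
    P (A' `&` [set w | [seq X i w | i <- l] = v]) =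
    (\int[P]_(w in A) (phi w * pmf_seq [seq p i w | i <- l] v)%:E)%E) ->
  forall g : seq nat -> bool, P (A' `&` [set w | g [seq X i w | i <- l]]) =
    (\int[P]_(w in A) ((phi w)%:E * prob_seq [seq p i w | i <- l] g))%E.
Proof.
move=> mA; elim: l => [|i l IH] A' phi mA' mphi phi0 H g /=.
  have := H [::] erefl; rewrite /=.
  rewrite (_ : [set _ | _] = setT) ?setIT; last by apply/seteqP; split.
  case: (g _).
    rewrite (_ : [set _ | _] = setT) ?setIT; last by apply/seteqP; split.
    by move=> ->; apply: eq_integral => w _; rewrite mulr1 mule1.
  rewrite (_ : [set _ | _] = set0) ?setI0 ?measure0; last by apply/seteqP; split.
  by move=> _; rewrite integral0_eq// => w _; rewrite mule0.
pose Am m := A' `&` [set w | X i w = m].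
have mAm m : measurable (Am m) by apply: measurableI => //; exact: mX.
pose E m := Am m `&` [set w | g (m :: [seq X j w | j <- l])].
have -> : A' `&` [set w | g (X i w :: [seq X j w | j <- l])] = \bigcup_m E m.
  apply/seteqP; split=> [w [Aw gw]|w [m _ [[Aw /= <-] gw]]//].
  by exists (X i w).
have PE m : P (E m) = (\int[P]_(w in A) ((phi w * p i w m)%:E *
    prob_seq [seq p j w | j <- l] (fun v => g (m :: v))))%E.
  apply: (IH (Am m) (fun w => phi w * p i w m) _ _ _ _ (fun v => g (m :: v))) => //.
  + by apply: measurable_funM => //; exact: mp.
  + by move=> w; rewrite mulr_ge0.
  + move=> v sv; have := H (m :: v); rewrite /= sv => /(_ erefl).
    rewrite (_ : _ `&` _ = Am m `&` [set w | [seq X j w | j <- l] = v]); last first.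
      by apply/seteqP; split=> w /= [];
        [move=> Aw [Xm Xv]; split|move=> [Aw ->] ->].
    by move=> ->; apply: eq_integral => w _; rewrite mulrA.
rewrite measure_semi_bigcup.
- etransitivity; first by apply: eq_eseriesr => m _; exact: PE.
  rewrite -integral_nneseries//; first last.
  + by move=> m w _; rewrite mule_ge0 ?lee_fin ?mulr_ge0.
  + move=> m; apply: measurable_funTS; apply: emeasurable_funM.
      by apply/measurable_EFinP; apply: measurable_funM => //; exact: mp.
    exact: (measurable_prob_seq l (fun v => g (m :: v))).
  apply: eq_integral => w _; rewrite -nneseriesZl; last first.
    by move=> m _; rewrite mule_ge0 ?lee_fin.
  by apply: eq_eseriesr => m _; rewrite EFinM muleA.
- by move=> m; apply: measurableI => //; exact: (measurable_map_levels l (fun v => g (m :: v))).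
- apply/trivIsetP => m n _ _ /eqP mn; apply/seteqP; split=> // w [[[_ /= Xm] _] [[_ /= Xn] _]].
  by apply: mn; rewrite -Xm -Xn.
- apply: bigcupT_measurable => m; apply: measurableI => //.
  exact: (measurable_map_levels l (fun v => g (m :: v))).
Qed.

End ProductLaw.

(** * Finite weighted sums over words *)

Section WordExpectation.
Context {R : realType} {A : Type}.
Variables (xs : seq A) (p : A -> R).
Implicit Types (h : seq A -> R).

Fixpoint word_sum (n : nat) h : R :=
  if n is m.+1 then \sum_(x <- xs) p x * word_sum m (fun v => h (x :: v))
  else h [::].

Lemma eq_word_sum n h h' : (forall v, size v = n -> h v = h' v) ->
  word_sum n h = word_sum n h'.
Proof.
elim: n h h' => [|n IH] h h' hh' /=; first exact: hh'.
by apply: eq_bigr => x _; congr (_ * _); apply: IH => v sv; apply: hh' => /=; rewrite sv.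
Qed.

Lemma word_sumD n h h' :
  word_sum n (fun v => h v + h' v) = word_sum n h + word_sum n h'.
Proof.
elim: n h h' => [//|n IH] h h' /=; rewrite -big_split/=.
by apply: eq_bigr => x _; rewrite -mulrDr -IH.
Qed.

Lemma word_sumZ n c h : word_sum n (fun v => c * h v) = c * word_sum n h.
Proof.
elim: n h => [//|n IH] h /=; rewrite mulr_sumr.
by apply: eq_bigr => x _; rewrite IH mulrCA.
Qed.

Lemma word_sum0 n : word_sum n (fun=> 0) = 0.
Proof. by rewrite -[RHS](mul0r (word_sum n (fun=> 0))) -word_sumZ; apply: eq_word_sum => v _; rewrite mul0r. Qed.

Lemma word_sum_bigl (B : Type) (ys : seq B) (q : B -> R) n (h : B -> seq A -> R) :
  word_sum n (fun v => \sum_(y <- ys) q y * h y v) =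
  \sum_(y <- ys) q y * word_sum n (h y).
Proof.
elim: ys => [|y ys IH].
  by rewrite big_nil -[RHS](word_sum0 n); apply: eq_word_sum => v _; rewrite big_nil.
rewrite big_cons -IH -word_sumZ -word_sumD.
by apply: eq_word_sum => v _; rewrite big_cons.
Qed.

Lemma word_sum_cst n c : word_sum n (fun=> c) = (\sum_(x <- xs) p x) ^+ n * c.
Proof.
elim: n => [|n IH] /=; first by rewrite expr0 mul1r.
by rewrite exprS -mulrA -IH mulr_suml.
Qed.

Lemma word_sum_cat m n h :
  word_sum (m + n) h = word_sum m (fun u => word_sum n (fun v => h (u ++ v))).
Proof.
elim: m h => [//|m IH] h /=; apply: eq_bigr => x _.
by rewrite (IH (fun v => h (x :: v))).
Qed.

Hypothesis p_ge0 : forall x, 0 <= p x.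

Lemma ler_word_sum n h h' : (forall v, size v = n -> h v <= h' v) ->
  word_sum n h <= word_sum n h'.
Proof.
elim: n h h' => [|n IH] h h' hh' /=; first exact: hh'.
apply: ler_sum => x _; apply: ler_wpM2l => //.
by apply: IH => v sv; apply: hh' => /=; rewrite sv.
Qed.

Lemma word_sum_ge0 n h : (forall v, 0 <= h v) -> 0 <= word_sum n h.
Proof. by move=> h0; rewrite -(word_sum0 n); apply: ler_word_sum. Qed.

Lemma word_sum_cst_le n c : 0 <= c -> \sum_(x <- xs) p x <= 1 ->
  word_sum n (fun=> c) <= c.
Proof.
move=> c0 s1; rewrite word_sum_cst -[leRHS]mul1r ler_wpM2r// exprn_ile1//.
exact: sumr_ge0.
Qed.

End WordExpectation.

Lemma word_sum_exchange {R : realType} {A B : Type} (xs : seq A) (p : A -> R)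
    (ys : seq B) (q : B -> R) m n (h : seq A -> seq B -> R) :
  word_sum xs p m (fun u => word_sum ys q n (h u)) =
  word_sum ys q n (fun v => word_sum xs p m (h ^~ v)).
Proof.
elim: m h => [//|m IH] h /=.
by under eq_bigr do rewrite IH; rewrite -word_sum_bigl.
Qed.

(** Only total mass at most 1 is assumed, since the queue-length law will be cut off at a finite
    length. *)
Lemma word_sum_sumn {R : realType} (xs : seq nat) (p : nat -> R) n (m : R) :
  (forall x, 0 <= p x) -> \sum_(x <- xs) p x <= 1 ->
  \sum_(x <- xs) p x * x%:R <= m ->
  word_sum xs p n (fun v => (sumn v)%:R) <= n%:R * m.
Proof.
move=> p0 p1 pm; elim: n => [|n IH]; first by rewrite mul0r.
rewrite -natr1 mulrDl mul1r [leRHS]addrC /=.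
have -> : \sum_(x <- xs) p x * word_sum xs p n (fun v => (x + sumn v)%:R) =
    \sum_(x <- xs) p x * word_sum xs p n (fun=> x%:R) +
    (\sum_(x <- xs) p x) * word_sum xs p n (fun v => (sumn v)%:R).
  rewrite mulr_suml -big_split/=; apply: eq_bigr => x _.
  rewrite -mulrDr -word_sumD; congr (_ * _); apply: eq_word_sum => v _.
  by rewrite natrD.
apply: lerD.
  apply: le_trans pm; apply: ler_sum => x _; apply: ler_wpM2l => //.
  exact: word_sum_cst_le.
apply: le_trans IH; rewrite -[leRHS]mul1r ler_wpM2r//.
by apply: word_sum_ge0 => // v; rewrite ler0n.
Qed.

(** * A single discrete-time queue and Burke's theorem *)

Section Queues.
Context {R : realType}.
Implicit Types (a s w : seq bool) (f : seq bool -> R).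

Definition bernoulli_weight (al : R) (b : bool) : R := if b then al else 1 - al.

Definition bernoulli_sum (al : R) (n : nat) f : R :=
  word_sum [:: true; false] (bernoulli_weight al) n f.

Lemma bernoulli_weight_ge0 al b : 0 <= al <= 1 -> 0 <= bernoulli_weight al b.
Proof. by move=> /andP[? ?]; case: b; rewrite /= ?subr_ge0. Qed.

Lemma bernoulli_weight_sum al : \sum_(b <- [:: true; false]) bernoulli_weight al b = 1.
Proof. by rewrite !big_cons big_nil /=; ring. Qed.

Lemma bernoulli_sumS al n f : bernoulli_sum al n.+1 f =
  al * bernoulli_sum al n (fun v => f (true :: v)) +
  (1 - al) * bernoulli_sum al n (fun v => f (false :: v)).
Proof. by rewrite /bernoulli_sum /= !big_cons big_nil addr0. Qed.

(* Departures of a discrete-time queue of initial length [q]: a customer leaves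
   at a step when [s] offers a service and the queue was nonempty before the
   arrival of that step. *)
Fixpoint departures (q : nat) a s : seq bool :=
  match a, s with
  | x :: a', y :: s' =>
      let b := y && (0 < q)%N in b :: departures (q - b + x) a' s'
  | _, _ => [::]
  end.

Lemma size_departures q a s : size a = size s -> size (departures q a s) = size a.
Proof. by elim: a s q => [|x a IH] [|y s] q //= [/IH ->]. Qed.

(** The queue length before step [j] is [q] plus the earlier arrivals minus the earlier departures.
    Expressed through these counts, a nonempty queue can be compared with the exclusion rule. *)
Lemma departuresP q a s j : size a = size s ->
  nth false (departures q a s) j =
  nth false s j && (count id (take j (departures q a s)) < q + count id (take j a))%N.
Proof.
elim: a s q j => [|x a IH] [|y s] q j //=; first by rewrite !nth_nil.
move=> [sz]; case: j => [|j] /=; first by rewrite addn0.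
rewrite IH//; congr (_ && _).
by case: y; case: q => [|q] /=; lia.
Qed.

Section Burke.
Variables (al be : R) (pi : nat -> R).
Hypotheses (al01 : 0 <= al <= 1) (be01 : 0 <= be <= 1).
Hypothesis pi_ge0 : forall q, 0 <= pi q.
Hypothesis pi1 : pi 1%N * (be * (1 - al)) = pi 0%N * al.
Hypothesis piS : forall q, pi q.+2 * (be * (1 - al)) = pi q.+1 * (al * (1 - be)).

(** One step of the queue from length [q], with [g] evaluated at the departure indicator and the
    next length. An arrival cannot be served in its own step. *)
Let step (g : bool -> nat -> R) (q : nat) : R :=
  al * (be * g (0 < q)%N (q - (0 < q) + 1)%N + (1 - be) * g false (q + 1)%N) +
  (1 - al) * (be * g (0 < q)%N (q - (0 < q))%N + (1 - be) * g false q).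

(** Under the invariant law the departure is Bernoulli [al] and independent of the next length. The
    correction is the flux across the cutoff: jumps from [K] to [K.+1] are in excess, those from
    [K.+1] to [K] are missing, and detailed balance gives both the same weight. *)
Let step_sum g K : \sum_(0 <= q < K.+1) pi q * step g q =
  \sum_(0 <= q < K.+1) pi q * (al * g true q + (1 - al) * g false q) +
  pi K.+1 * (be * (1 - al)) * (g false K.+1 - g true K).
Proof.
elim: K => [|K IH].
  by rewrite !big_nat1 pi1 /step /=; ring.
rewrite big_nat_recr//= [in RHS]big_nat_recr//= IH piS /step /= !subn1 /= !addn1.
by ring.
Qed.

(* Reversibility of the queue in equilibrium, summed over queue lengths below a
   cutoff that grows by one at each step. *)
Lemma burke M n f : (forall v, 0 <= f v) ->
  \sum_(0 <= q < M) pi q * bernoulli_sum al n (fun a =>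
     bernoulli_sum be n (fun s => f (departures q a s))) <=
  (\sum_(0 <= q < M + n) pi q) * bernoulli_sum al n f.
Proof.
have /andP[al_ge0 al_le1] := al01; have /andP[be_ge0 be_le1] := be01.
elim: n M f => [|n IH] M f f0.
  by rewrite addn0 mulr_suml /bernoulli_sum /=; apply: ler_sum.
pose g (b : bool) q := bernoulli_sum al n (fun a =>
  bernoulli_sum be n (fun s => f (b :: departures q a s))).
have g0 b q : 0 <= g b q.
  by apply: word_sum_ge0 => [x|v]; [exact: bernoulli_weight_ge0|
    apply: word_sum_ge0 => [x|u //]; exact: bernoulli_weight_ge0].
have gE q : bernoulli_sum al n.+1 (fun a =>
     bernoulli_sum be n.+1 (fun s => f (departures q a s))) = step g q.
  rewrite bernoulli_sumS /step; congr (_ * _ + _ * _).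
    rewrite /g /bernoulli_sum -!word_sumZ -word_sumD; apply: eq_word_sum => a _.
    by rewrite -[LHS]/(bernoulli_sum _ _ _) bernoulli_sumS /= subn0.
  rewrite /g /bernoulli_sum -!word_sumZ -word_sumD; apply: eq_word_sum => a _.
  by rewrite -[LHS]/(bernoulli_sum _ _ _) bernoulli_sumS /= subn0 !addn0.
under eq_bigr do rewrite gE.
(* The boundary term of [step_sum] is absorbed by the new summand [q = M]; this is what the growth
   of the cutoff is for. *)
apply: (@le_trans _ _ (\sum_(0 <= q < M.+1) pi q * (al * g true q + (1 - al) * g false q))).
  case: M => [|K].
    rewrite big_geq// sumr_ge0// => q _; rewrite mulr_ge0// addr_ge0// mulr_ge0//; lra.
  rewrite step_sum [leRHS]big_nat_recr//= lerD2l.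
  have : 0 <= pi K.+1 * (1 - al) by rewrite mulr_ge0//; lra.
  have := g0 false K.+1; have := g0 true K; have := g0 true K.+1; have := pi_ge0 K.+1.
  move=> h1 h2 h3 h4 h5.
  rewrite (_ : pi K.+1 * (be * (1 - al)) * (g false K.+1 - g true K) =
    be * (pi K.+1 * (1 - al) * g false K.+1) - be * (pi K.+1 * (1 - al) * g true K)); last by ring.
  apply: (@le_trans _ _ (pi K.+1 * (1 - al) * g false K.+1)).
    rewrite lerBlDr -[leLHS]addr0 lerD//.
      by rewrite ler_piMl ?mulr_ge0 ?subr_ge0.
    by rewrite !mulr_ge0 ?subr_ge0.
  by rewrite -mulrA ler_wpM2l// lerDr mulr_ge0.
have split_sum : \sum_(0 <= q < M.+1) pi q * (al * g true q + (1 - al) * g false q) =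
    al * (\sum_(0 <= q < M.+1) pi q * g true q) +
    (1 - al) * (\sum_(0 <= q < M.+1) pi q * g false q).
  by rewrite !mulr_sumr -big_split; apply: eq_bigr => q _ /=; ring.
rewrite split_sum bernoulli_sumS mulrDr addnS -addSn.
rewrite !(mulrCA _ al) !(mulrCA _ (1 - al)).
apply: lerD; apply: ler_wpM2l; try lra.
  exact: (IH M.+1 (fun v => f (true :: v))).
exact: (IH M.+1 (fun v => f (false :: v))).
Qed.

End Burke.

End Queues.

(** * Queues in series and their comparison with the particles *)

Section Tandem.
Context {R : realType}.
Implicit Types (a s w : seq bool) (Q : seq nat) (tau : R).

(* Queues in series with initial lengths [Q]; the services of all queues over
   [J] steps are concatenated in the word [s]. *)
Fixpoint tandem (J : nat) Q a s : seq bool :=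
  if Q is q :: Q' then tandem J Q' (departures q a (take J s)) (drop J s) else a.

(** The gap in front of a particle is a queue: moves of the particle ahead are arrivals, rings are
    services, own moves are departures. For the path at [x0 - 1 - q] plus departures, the free-site
    condition of [xi_ge_discrete] is the nonempty-queue condition of [departuresP]. Any [q] is
    allowed, since a larger gap only puts this path further behind. *)
Lemma xi_ge_queue (M : nat -> R -> nat) k (x0 : int) q a s tau :
  (forall k, counting_path (M k)) -> 0 <= tau -> size a = size s ->
  (forall l, k = l.+1 -> forall j,
     x0 + (count id (take j a))%:Z <= xi M l (j%:R * tau)) ->
  x0 <= 1 - k%:Z ->
  (forall j, nth false s j -> (M k (j%:R * tau)%R < M k (j.+1%:R * tau)%R)%N) ->
  forall j, x0 - 1 - q%:Z + (count id (take j (departures q a s)))%:Z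
    <= xi M k (j%:R * tau).
Proof.
move=> cM tau0 sz lead x0k ring.
apply: (xi_ge_discrete (lead := fun j => x0 + (count id (take j a))%:Z)) => //.
  by rewrite take0 /=; lia.
move=> j; set w := departures q a s.
have cS : count id (take j.+1 w) = (nth false w j + count id (take j w))%N.
  have [jw|wj] := ltnP j (size w).
    by rewrite (take_nth false jw) -cats1 count_cat /= addn0 addnC.
  by rewrite !take_oversize ?nth_default//; lia.
have wP := departuresP q j sz; rewrite -/w in wP.
rewrite cS; case wj : (nth false w j); last by left; lia.
move: wP; rewrite wj => /esym /andP[sj lt_q]; right; split; [lia|exact: ring|lia].
Qed.

(** The output of each queue feeds the next one. For [k = 0] the hypothesis on the particle ahead is
    vacuous: [a] is then the path of a virtual leader, which may start at site 1. *)
Lemma xi_ge_tandem (M : nat -> R -> nat) J tau :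
  (forall k, counting_path (M k)) -> 0 <= tau ->
  forall Q k (x0 : int) a s, size a = J -> size s = (size Q * J)%N ->
  (forall l, k = l.+1 -> forall j,
     x0 + (count id (take j a))%:Z <= xi M l (j%:R * tau)) ->
  x0 <= 1 - k%:Z ->
  (forall i j, (i < size Q)%N -> (j < J)%N -> nth false s (i * J + j) ->
     (M (k + i)%N (j%:R * tau)%R < M (k + i)%N (j.+1%:R * tau)%R)%N) ->
  forall l, (k + size Q = l.+1)%N ->
  x0 - (size Q)%:Z - (sumn Q)%:Z + (count id (tandem J Q a s))%:Z
    <= xi M l (J%:R * tau).
Proof.
move=> cM tau0; elim=> [|q Q IH] k x0 a s sa ss lead x0k ring l /=.
  by rewrite addn0 => kl; have := lead l kl J; rewrite -sa take_size; lia.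
move=> kl; have sz : size a = size (take J s).
  by rewrite size_takel// ss /= mulSn leq_addr.
have := IH k.+1 (x0 - 1 - q%:Z) (departures q a (take J s)) (drop J s).
rewrite size_departures// size_drop ss /= mulSn addKn => /(_ sa erefl) IH'.
have {IH'} := IH' _ _ _ l; rewrite addSnnS kl.
have -> : (x0 - (size Q).+1%:Z - (q + sumn Q)%:Z)%R = x0 - 1 - q%:Z - (size Q)%:Z - (sumn Q)%:Z.
  by lia.
apply => //.
- move=> l' [<-]; apply: xi_ge_queue => // j.
  have [jJ|Jj] := ltnP j J; last by rewrite nth_default// -sz sa.
  by rewrite nth_take// => sj; have := ring 0%N j isT jJ; rewrite addn0; apply.
- by lia.
- move=> i j iQ jJ; rewrite nth_drop addnA -mulSn addSnnS.
  exact: ring.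
Qed.

Section TandemLaw.
Variables (al be : R) (pi : nat -> R).
Hypotheses (al01 : 0 <= al <= 1) (be01 : 0 <= be <= 1).
Hypothesis pi_ge0 : forall q, 0 <= pi q.
Hypothesis pi_sum_le1 : forall M, \sum_(0 <= q < M) pi q <= 1.
Hypothesis pi1 : pi 1%N * (be * (1 - al)) = pi 0%N * al.
Hypothesis piS : forall q, pi q.+2 * (be * (1 - al)) = pi q.+1 * (al * (1 - be)).

(** Burke's theorem removes the first queue, whose output is again Bernoulli [al]; the law cut off
    at any length has mass at most 1, hence an inequality. *)
Lemma bernoulli_tandem M J n (f : seq bool -> R) : (forall v, 0 <= f v) ->
  bernoulli_sum al J (fun a => word_sum (index_iota 0 M) pi n (fun Q =>
    bernoulli_sum be (n * J) (fun s => f (tandem J Q a s))))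
  <= bernoulli_sum al J f.
Proof.
move=> f0; have w0 be' : 0 <= be' <= 1 -> forall b, 0 <= bernoulli_weight be' b.
  by move=> ? b; exact: bernoulli_weight_ge0.
elim: n => [|n IH] //=.
pose H a := word_sum (index_iota 0 M) pi n (fun Q =>
    bernoulli_sum be (n * J) (fun s => f (tandem J Q a s))).
have H0 a : 0 <= H a.
  by apply: word_sum_ge0 => // Q; apply: word_sum_ge0 => //; exact: w0.
apply: le_trans IH; rewrite -/H.
apply: (@le_trans _ _ (\sum_(0 <= q < M) pi q * bernoulli_sum al J (fun a =>
     bernoulli_sum be J (fun s => H (departures q a s))))).
  rewrite le_eqVlt; apply/orP; left; apply/eqP.
  rewrite /bernoulli_sum -word_sum_bigl; apply: eq_word_sum => a _.
  apply: eq_bigr => q _; congr (_ * _); rewrite [RHS]word_sum_exchange.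
  apply: eq_word_sum => Q sQ; rewrite mulSn word_sum_cat.
  apply: eq_word_sum => u su; apply: eq_word_sum => v _.
  by rewrite take_size_cat// drop_size_cat.
apply: (le_trans (burke al01 be01 pi_ge0 pi1 piS M J H0)).
rewrite -[leRHS]mul1r ler_wpM2r//.
by apply: word_sum_ge0 => //; exact: w0.
Qed.

(* [p] bounds the probability of a bad event for every choice of initial queue
   lengths and arrivals; averaging over the invariant law of the queues makes
   the output of the tandem a Bernoulli sequence of density [al]. *)
Lemma tandem_bound (p ct h m : R) M J n :
  0 < h -> 0 <= p -> \sum_(0 <= q < M) pi q * q%:R <= m ->
  (forall Q a, size Q = n -> size a = J ->
    p <= bernoulli_sum be (n * J) (fun s =>
      ((1 - n%:Z - (sumn Q)%:Z + (count id (tandem J Q a s))%:Z)%:~R <= ct)%R%:R)) ->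
  p * (\sum_(0 <= q < M) pi q) ^+ n <=
  bernoulli_sum al J (fun v => ((count id v)%:R <= ct + n%:R + h)%R%:R) + n%:R * m / h.
Proof.
move=> h0 p0 pim bad.
have w0 be' : 0 <= be' <= 1 -> forall b, 0 <= bernoulli_weight be' b.
  by move=> ? b; exact: bernoulli_weight_ge0.
pose F v : R := ((count id v)%:R <= ct + n%:R + h)%R%:R.
have -> : p * (\sum_(0 <= q < M) pi q) ^+ n =
    bernoulli_sum al J (fun=> word_sum (index_iota 0 M) pi n (fun=> p)).
  by rewrite /bernoulli_sum !word_sum_cst bernoulli_weight_sum expr1n mul1r mulrC.
(* Markov's inequality for the total gap: either it is at most [h], and being late forces few
   departures, or [sumn Q / h] exceeds 1. *)
apply: (@le_trans _ _ (bernoulli_sum al J (fun a => word_sum (index_iota 0 M) pi n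
    (fun Q => bernoulli_sum be (n * J) (fun s => F (tandem J Q a s)) + h^-1 * (sumn Q)%:R)))).
  apply: ler_word_sum => [|a sa]; first exact: w0.
  apply: ler_word_sum => // Q sQ; apply: le_trans (bad Q a sQ sa) _.
  have -> : h^-1 * (sumn Q)%:R = bernoulli_sum be (n * J) (fun=> h^-1 * (sumn Q)%:R).
    by rewrite /bernoulli_sum !word_sum_cst bernoulli_weight_sum expr1n mul1r.
  rewrite -word_sumD; apply: ler_word_sum => [|s _]; first exact: w0.
  rewrite /F; case: (leP (sumn Q)%:R h) => Qh.
    have hQ : 0 <= h^-1 * (sumn Q)%:R by rewrite mulr_ge0 ?invr_ge0// ltW.
    case: (boolP (_ <= ct)) => [H1|_]; last by rewrite addr_ge0.
    have -> : (count id (tandem J Q a s))%:R <= ct + n%:R + h.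
      by move: H1; rewrite !rmorphD/= !rmorphN/= -!pmulrn => H1; lra.
    by rewrite lerDl.
  apply: (@le_trans _ _ (h^-1 * (sumn Q)%:R)); last by rewrite lerDr.
  apply: (@le_trans _ _ 1); first by case: (_ <= ct).
  by rewrite mulrC ler_pdivlMr// mul1r ltW.
rewrite /bernoulli_sum.
under eq_word_sum do rewrite word_sumD.
rewrite word_sumD; apply: lerD; first exact: bernoulli_tandem.
rewrite word_sum_cst bernoulli_weight_sum expr1n mul1r word_sumZ mulrC.
by rewrite ler_pM2r ?invr_gt0//; apply: word_sum_sumn.
Qed.

End TandemLaw.

End Tandem.

(** * The invariant queue law and removal of the cutoff *)

Section StationaryTandem.
Context {R : realType}.

(** Chernoff's bound with [u = y / (2 mu)], the minimiser of [mu u^2 - y u], which is the exponent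
    left by exp(-u) <= 1 - u + u^2. *)
Lemma bernoulli_sum_count_le (al y : R) (J : nat) :
  0 < al <= 1 -> 0 <= y -> (0 < J)%N ->
  bernoulli_sum al J (fun v => ((count id v)%:R <= J%:R * al - y)%R%:R)
  <= expR (- (y ^+ 2 / (4 * (J%:R * al)))).
Proof.
move=> /andP[al0 al1] y0 J0; set mu := J%:R * al.
have mu0 : 0 < mu by rewrite mulr_gt0 ?ltr0n.
have al01 : 0 <= al <= 1 by rewrite ltW.
pose u := y / (2 * mu).
have u0 : 0 <= u by rewrite divr_ge0// mulr_ge0// ltW.
have markov : bernoulli_sum al J (fun v => ((count id v)%:R <= mu - y)%R%:R) <=
    expR ((mu - y) * u) * bernoulli_sum al J (fun v => expR (- u) ^+ count id v).
  rewrite /bernoulli_sum -word_sumZ; apply: ler_word_sum => [b|v _].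
    exact: bernoulli_weight_ge0.
  case: (boolP (_ <= mu - y)) => [le_v|_]; last by rewrite mulr_ge0 ?exprn_ge0 ?expR_ge0.
  rewrite -expRM_natr -expRD -[leLHS]expR0 ler_expR.
  by rewrite mulNr [u * _]mulrC -mulrBl mulr_ge0// subr_ge0.
have mgf n : bernoulli_sum al n (fun v => expR (- u) ^+ count id v) =
    (1 - al + al * expR (- u)) ^+ n.
  elim: n => [|n IH]; first by rewrite expr0 /bernoulli_sum.
  rewrite bernoulli_sumS exprS /=.
  rewrite -[X in al * X](_ : expR (- u) * bernoulli_sum al n (fun v => expR (- u) ^+ count id v) = _).
    by rewrite IH; ring.
  by rewrite /bernoulli_sum -word_sumZ; apply: eq_word_sum => v _; rewrite exprS.
apply: (le_trans markov); rewrite mgf.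
have eu : expR (- u) <= 1 - u + u ^+ 2.
  rewrite expRN; have := expR_ge1Dx u => h.
  rewrite invf_ple ?posrE ?expR_gt0//; last by nra.
  apply: le_trans h; rewrite -[leLHS]mul1r ler_pdivrMr; nra.
have le_base : 1 - al + al * expR (- u) <= expR (- (al * (u - u ^+ 2))).
  apply: le_trans (expR_ge1Dx _); nra.
have base0 : 0 <= 1 - al + al * expR (- u).
  by rewrite addr_ge0 ?subr_ge0// mulr_ge0 ?expR_ge0// ltW.
apply: (@le_trans _ _ (expR ((mu - y) * u) * expR (- (al * (u - u ^+ 2))) ^+ J)).
  by rewrite ler_wpM2l ?expR_ge0// lerXn2r ?nnegrE ?expR_ge0.
rewrite -expRM_natr -expRD ler_expR le_eqVlt; apply/orP; left; apply/eqP.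
rewrite (_ : - (al * (u - u ^+ 2)) * J%:R = - (mu * (u - u ^+ 2))); last by rewrite /mu; ring.
by rewrite /u; field; rewrite gt_eqF.
Qed.

Variables al be : R.
Hypotheses (al0 : 0 < al) (al_be : al < be) (be1 : be < 1).

Let rho : R := al * (1 - be) / (be * (1 - al)).
Let r : R := al / be.

(* Stationary queue length before an arrival, for arrival and service
   probabilities [al] and [be]. *)
Definition queue_law (q : nat) : R :=
  if q is q'.+1 then r * (1 - rho) * rho ^+ q' else 1 - r.

Let be0 : 0 < be. Proof. exact: lt_trans al_be. Qed.
Let al1 : al < 1. Proof. exact: lt_trans be1. Qed.

Let rho0 : 0 <= rho.
Proof. by rewrite divr_ge0// mulr_ge0 ?subr_ge0// ltW. Qed.

Let rho1 : rho < 1.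
Proof. rewrite ltr_pdivrMr ?mulr_gt0 ?subr_gt0// mul1r !mulrBr !mulr1 (mulrC be).
by rewrite ltrD2r. Qed.

Let r01 : 0 < r < 1.
Proof. by rewrite divr_gt0//= ltr_pdivrMr// mul1r. Qed.

Lemma queue_law_ge0 q : 0 <= queue_law q.
Proof.
have /andP[/ltW r0 /ltW r1] := r01; case: q => [|q] /=; first by rewrite subr_ge0.
by rewrite mulr_ge0 ?exprn_ge0// mulr_ge0// subr_ge0 ltW.
Qed.

Lemma queue_law_sum M : \sum_(0 <= q < M.+1) queue_law q = 1 - r * rho ^+ M.
Proof.
elim: M => [|M IH]; first by rewrite big_nat1 /= expr0 mulr1.
by rewrite big_nat_recr//= IH exprS; ring.
Qed.

Lemma queue_law_sum_le1 M : \sum_(0 <= q < M) queue_law q <= 1.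
Proof.
case: M => [|M]; first by rewrite big_geq.
have /andP[/ltW ? _] := r01.
by rewrite queue_law_sum gerBl mulr_ge0 ?exprn_ge0.
Qed.

(** The bound is the full mean [r / (1 - rho)], from which the truncated one differs by an explicit
    nonnegative tail. Its denominator [be - al] is what makes the gaps of order 1 / eta. *)
Lemma queue_law_mean M :
  \sum_(0 <= q < M) queue_law q * q%:R <= al * (1 - al) / (be - al).
Proof.
have /andP[/ltW r0 _] := r01.
have rho1' : 1 - rho != 0 by rewrite subr_eq0 gt_eqF.
have -> : al * (1 - al) / (be - al) = r / (1 - rho).
  have ne : [&& be != 0, 1 - al != 0 & be - al != 0].
    by rewrite !gt_eqF ?subr_gt0.
  have -> : 1 - rho = (be - al) / (be * (1 - al)).
    by rewrite /rho; field; case/and3P: ne => -> ->.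
  by rewrite /r; field; case/and3P: ne => -> -> ->.
case: M => [|M]; first by rewrite big_geq// divr_ge0// subr_ge0 ltW.
have -> : \sum_(0 <= q < M.+1) queue_law q * q%:R =
    r / (1 - rho) - r * rho ^+ M * (M%:R + (1 - rho)^-1).
  elim: M => [|M IH]; first by rewrite big_nat1 mulr0 expr0; field.
  by rewrite big_nat_recr//= IH exprS -natr1; field.
rewrite gerBl; apply: mulr_ge0; first by rewrite mulr_ge0 ?exprn_ge0.
by rewrite addr_ge0// invr_ge0 subr_ge0 ltW.
Qed.

Lemma queue_law_balance1 : queue_law 1 * (be * (1 - al)) = queue_law 0 * al.
Proof.
rewrite /= /r /rho expr0; field.
by rewrite !gt_eqF ?mulr_gt0 ?subr_gt0.
Qed.

Lemma queue_law_balanceS q :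
  queue_law q.+2 * (be * (1 - al)) = queue_law q.+1 * (al * (1 - be)).
Proof.
rewrite /= exprS; set x := rho ^+ q; rewrite {2}/rho; field.
by rewrite !gt_eqF ?mulr_gt0 ?subr_gt0.
Qed.

(** The right-hand side of [tandem_bound], with this mean, does not involve [M], and the [n]-th
    power of the mass [1 - r rho^M] tends to 1, so the cutoff disappears in the limit. *)
Lemma stationary_tandem_bound (p ct h : R) J n :
  0 < h -> 0 <= p ->
  (forall Q a, size Q = n -> size a = J ->
    p <= bernoulli_sum be (n * J) (fun s =>
      ((1 - n%:Z - (sumn Q)%:Z + (count id (tandem J Q a s))%:Z)%:~R <= ct)%R%:R)) ->
  p <= bernoulli_sum al J (fun v => ((count id v)%:R <= ct + n%:R + h)%R%:R)
       + n%:R * (al * (1 - al) / (be - al)) / h.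
Proof.
move=> h0 p0 bad; set B := _ + _.
have al01 : 0 <= al <= 1 by rewrite !ltW.
have be01 : 0 <= be <= 1 by rewrite !ltW.
have le_B M : p * (1 - r * rho ^+ M) ^+ n <= B.
  rewrite -queue_law_sum; apply: (tandem_bound al01 be01) => //.
  - exact: queue_law_ge0.
  - exact: queue_law_sum_le1.
  - exact: queue_law_balance1.
  - exact: queue_law_balanceS.
  - exact: queue_law_mean.
have cvg_mass : 1 - r * rho ^+ M @[M --> \oo] --> 1 - r * 0.
  apply: cvgB; first exact: cvg_cst.
  by apply: cvgM; [exact: cvg_cst|apply: cvg_expr; rewrite ger0_norm].
have cvgM : p * (1 - r * rho ^+ M) ^+ n @[M --> \oo] --> p * (1 - r * 0) ^+ n.
  apply: cvgM; first exact: cvg_cst.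
  exact: (cvg_comp _ (fun x : R => x ^+ n) cvg_mass (@exprn_continuous _ _ _)).
rewrite mulr0 subr0 expr1n mulr1 in cvgM.
by apply: (cvgr_to_le cvgM); exact: nearW.
Qed.

End StationaryTandem.

(** * Stochastic domination and product bounds for [prob_seq] *)

Section SeriesBounds.
Context {R : realType}.
Local Open Scope ereal_scope.

(** Stochastic domination without a coupling. Conditioning on the first cell gives a mixture of two
    values [e true <= e false], which increases with the probability [p i 0] that the cell is empty,
    itself at most [1 - be]. *)
Lemma prob_seq_le_bernoulli (I : eqType) (l : seq I) (p : I -> nat -> R)
    (be : R) (g : seq bool -> bool) :
  (0 <= be <= 1)%R -> (forall i m, (0 <= p i m)%R) ->
  {in l, forall i, \sum_(m <oo) (p i m)%:E = 1} ->
  {in l, forall i, (p i 0%N <= 1 - be)%R} ->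
  (forall u v, size u = size v -> (forall i, nth false u i -> nth false v i) ->
     g v -> g u) ->
  prob_seq [seq p i | i <- l] (fun v => g [seq (0 < m)%N | m <- v]) <=
  (bernoulli_sum be (size l) (fun v => (g v)%:R))%:E.
Proof.
move=> be01 p0; elim: l g => [//|i l IH] g p1 pbe gdec.
have IHb b : prob_seq [seq p i | i <- l] (fun v => g (b :: [seq (0 < m)%N | m <- v])) <=
    (bernoulli_sum be (size l) (fun v => (g (b :: v))%:R))%:E.
  apply: (IH (fun v => g (b :: v))) => [j jl|j jl|u v suv uv].
  - by apply: p1; rewrite inE jl orbT.
  - by apply: pbe; rewrite inE jl orbT.
  - by apply: gdec => /=; [rewrite suv|case].
have {}p1 := p1 i (mem_head _ _); have {}pbe := pbe i (mem_head _ _).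
pose e b : R := bernoulli_sum be (size l) (fun v => (g (b :: v))%:R).
have {}IHb b : prob_seq [seq p i | i <- l] (fun v => g (b :: [seq (0 < m)%N | m <- v]))
    <= (e b)%:E by exact: IHb.
have e01 : (0 <= e true <= e false)%R.
  apply/andP; split.
    by apply: word_sum_ge0 => // b; exact: bernoulli_weight_ge0.
  apply: ler_word_sum => [b|v _]; first exact: bernoulli_weight_ge0.
  by rewrite ler_nat; case: (boolP (g (true :: v))) => // /gdec -> // [].
rewrite [size _]/= bernoulli_sumS -/(e true) -/(e false) /=.
apply: (@le_trans _ _ (\sum_(m <oo) ((e true)%:E * (p i m)%:E +
   (if m == 0%N then (p i 0%N * (e false - e true))%:E else 0)))).
  apply: lee_nneseries => [m _ _|m _].
    by rewrite mule_ge0 ?lee_fin ?p0// prob_seq_ge0.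
  case: m => [|m] /=.
    rewrite -EFinM -EFinD (_ : (_ + _)%R = (p i 0%N * e false)%R); last by ring.
    by rewrite EFinM lee_wpmul2l ?lee_fin.
  by rewrite adde0 muleC lee_wpmul2r ?lee_fin.
rewrite nneseriesD; first last.
- by move=> [|m] _ _ //; rewrite lee_fin mulr_ge0// subr_ge0; case/andP: e01.
- by move=> m _ _; rewrite mule_ge0 ?lee_fin//; case/andP: e01.
rewrite nneseriesZl; last by move=> m _; rewrite lee_fin.
rewrite p1 mule1 (nneseries_split 0 1); last first.
  by move=> [|m] _ //; rewrite lee_fin mulr_ge0// subr_ge0; case/andP: e01.
rewrite big_nat1 /= eseries0 ?adde0; last by move=> [|m].
rewrite -EFinD lee_fin; case/andP: e01 => e1 e2; nra.
Qed.

Lemma prob_seq_all_le (I : eqType) (l : seq I) (p : I -> nat -> R) (a : pred nat)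
    (u : I -> R) :
  (forall i m, (0 <= p i m)%R) -> (forall i, (0 <= u i)%R) ->
  {in l, forall i, \sum_(m <oo) (if a m then (p i m)%:E else 0) <= (u i)%:E} ->
  prob_seq [seq p i | i <- l] (all a) <= (\prod_(i <- l) u i)%:E.
Proof.
move=> p0 u0; have ps_false (l' : seq I) (g : seq nat -> bool) : (forall v, g v = false) ->
    prob_seq [seq p i | i <- l'] g = 0.
  elim: l' g => [|j l' IH] g g0 /=; first by rewrite g0.
  by rewrite eseries0// => m _ _; rewrite IH ?mule0.
elim: l => [|i l IH] pu /=; first by rewrite big_nil.
have {}IH : prob_seq [seq p i | i <- l] (all a) <= (\prod_(j <- l) u j)%:E.
  by apply: IH => j jl; apply: pu; rewrite inE jl orbT.
have ul0 : (0 <= \prod_(j <- l) u j)%R by rewrite prodr_ge0.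
rewrite big_cons mulrC EFinM.
apply: (@le_trans _ _ ((\prod_(j <- l) u j)%:E *
    \sum_(m <oo) (if a m then (p i m)%:E else 0))); last first.
  by rewrite lee_wpmul2l ?lee_fin// pu ?mem_head.
rewrite -nneseriesZl; last by move=> m _; case: ifP => // _; rewrite lee_fin.
apply: lee_nneseries => [m _ _|m _].
  by rewrite mule_ge0 ?lee_fin ?prob_seq_ge0.
case: ifP => am /=; last by rewrite ps_false ?mule0.
by rewrite muleC lee_wpmul2r ?lee_fin.
Qed.

End SeriesBounds.

(** * Poisson estimates *)

Section Poisson.
Context {R : realType}.
Implicit Types (la mu x v w : R).

Lemma poisson_pmf_sum la : 0 < la -> (\sum_(m <oo) (poisson_pmf la m)%:E = 1)%E.
Proof.
move=> la0; have := probability_setT (poisson_prob la 0).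
rewrite /= /poisson_prob la0 => <-.
by rewrite nneseries_esumT// => m; rewrite lee_fin poisson_pmf_ge0.
Qed.

Lemma poisson_pmf0 la : 0 < la -> poisson_pmf la 0 = expR (- la).
Proof. by move=> la0; rewrite /poisson_pmf la0 expr0 fact0 invr1 !mul1r. Qed.

(** A Poisson law tilted by exp(v m) is a multiple of the Poisson law of parameter la exp(v). The
    constant [w] prepares the use in Chernoff bounds. *)
Lemma poisson_mgf la v w : 0 < la ->
  (\sum_(m <oo) (poisson_pmf la m * expR (v * m%:R + w))%:E =
   (expR (la * (expR v - 1) + w))%:E)%E.
Proof.
move=> la0; have lav0 : 0 < la * expR v by rewrite mulr_gt0 ?expR_gt0.
transitivity (\sum_(m <oo) (expR (la * (expR v - 1) + w))%:E *
    (poisson_pmf (la * expR v) m)%:E)%E.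
  apply: eq_eseriesr => m _; rewrite -EFinM; congr (_%:E).
  rewrite /poisson_pmf la0 lav0 exprMn -expRM_natr.
  have -> : expR (- la) = expR (la * (expR v - 1)) * expR (- (la * expR v)).
    by rewrite -expRD; congr expR; ring.
  by rewrite !expRD; ring.
rewrite nneseriesZl; last by move=> m _; rewrite lee_fin poisson_pmf_ge0.
by rewrite poisson_pmf_sum// mule1.
Qed.

(** The likelihood ratio is (mu / la)^m exp(la - mu), and mu / la = 1 - (la - mu) / la is at most
    the exponential of -(la - mu) / la. *)
Lemma poisson_pmf_tilt la mu m : 0 < mu -> mu <= la ->
  poisson_pmf mu m <= poisson_pmf la m * expR ((la - mu) * (la - m%:R) / la).
Proof.
move=> mu0 mula; have la0 := lt_le_trans mu0 mula.
rewrite /poisson_pmf mu0 la0.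
have -> : expR ((la - mu) * (la - m%:R) / la) =
    expR la * expR (- mu) * expR (- ((la - mu) / la)) ^+ m.
  rewrite -expRM_natr -!expRD; congr expR; field.
  by rewrite gt_eqF.
have -> : la ^+ m / m`!%:R * expR (- la) * (expR la * expR (- mu) * expR (- ((la - mu) / la)) ^+ m)
    = (la * expR (- ((la - mu) / la))) ^+ m / m`!%:R * expR (- mu) * (expR (- la) * expR la).
  by rewrite exprMn; ring.
rewrite -expRD addNr expR0 mulr1 ler_wpM2r ?expR_ge0// ler_wpM2r ?invr_ge0//.
apply: lerXn2r; rewrite ?nnegrE ?mulr_ge0 ?expR_ge0 ?(ltW la0) ?(ltW mu0)//.
apply: (@le_trans _ _ (la * (1 + - ((la - mu) / la)))); last first.
  by rewrite ler_wpM2l ?(ltW la0)// expR_ge1Dx.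
by rewrite le_eqVlt; apply/orP; left; apply/eqP; field; rewrite gt_eqF.
Qed.

Lemma expR_le_quadratic v : 0 <= v <= 1 / 2 -> expR v <= 1 + v + 2 * v ^+ 2.
Proof.
move=> /andP[v0 v1]; have := expR_ge1Dx (- v); rewrite expRN => h.
have ev := expR_gt0 v.
have : (1 - v) * expR v <= 1 by rewrite -ler_pdivlMr// div1r.
nra.
Qed.

Lemma expRN_le_quadratic v : 0 <= v -> expR (- v) <= 1 - v + v ^+ 2.
Proof.
move=> v0; have := expR_ge1Dx v => h; have ev := expR_gt0 (- v).
have : (1 + v) * expR (- v) <= 1.
  by rewrite expRN -ler_pdivlMr ?invr_gt0 ?expR_gt0// invrK mul1r.
nra.
Qed.

(* Tilting the Poisson law of parameter [x - 4 sqrt x], which charges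
   [x - 8 sqrt x, x] with probability at least 5/12. *)
Lemma poisson_lower_tail (K : R) : 0 <= K ->
  exists2 de : R, 0 < de < 1 & forall x la, 64 <= x ->
    x <= la -> la <= x + K * Num.sqrt x ->
    (\sum_(m <oo) (if (x < m%:R)%R then (poisson_pmf la m)%:E else 0) <= (1 - de)%:E)%E.
Proof.
(* On [x - 8 sqrt x, x] the tilting exponent is at most the product of (K + 4) sqrt x and (K + 8)
   sqrt x divided by [la], hence at most [D] because [la >= x]. *)
move=> K0; pose D := (K + 4) * (K + 8).
have D0 : 0 <= D by rewrite mulr_ge0// addr_ge0.
exists (5 / 12 * expR (- D)).
  rewrite mulr_gt0 ?expR_gt0//=.
  have : expR (- D) <= 1 by rewrite -[leRHS]expR0 ler_expR oppr_le0.
  by have := expR_gt0 (- D); lra.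
move=> x la x64 xla laK.
have x0 : 0 <= x by lra.
pose si := Num.sqrt x; have si2 : si ^+ 2 = x by rewrite sqr_sqrtr.
have si0 : 0 <= si by rewrite sqrtr_ge0.
have si8 : 8 <= si by nra.
pose mu := x - 4 * si; pose y := x - 8 * si.
have mu0 : 0 < mu by rewrite /mu; nra.
have la0 : 0 < la by lra.
have mula : mu <= la by rewrite /mu; nra.
pose mid m : R := if (m%:R <= x) && (y <= m%:R) then poisson_pmf mu m else 0.
have mid_ge0 m : 0 <= mid m by rewrite /mid; case: ifP; rewrite // poisson_pmf_ge0.
have vsi : 0 <= si^-1 <= 1 / 2.
  by rewrite invr_ge0 si0 div1r lef_pV2 ?posrE//; lra.
have siV : si * si^-1 = 1 by rewrite divff// gt_eqF//; lra.
have e2 : expR (- 2) <= (1 / 3 : R).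
  by rewrite expRN div1r lef_pV2 ?posrE ?expR_gt0//; have := @expR_ge1Dx R 2; lra.
have e3 : expR (- 3) <= (1 / 4 : R).
  by rewrite expRN div1r lef_pV2 ?posrE ?expR_gt0//; have := @expR_ge1Dx R 3; lra.
have mid_mass : ((5 / 12)%:E <= \sum_(m <oo) (mid m)%:E)%E.
  have mgf v w : (forall m, 0 <= poisson_pmf mu m * expR (v * m%:R + w)).
    by move=> m; rewrite mulr_ge0 ?poisson_pmf_ge0 ?expR_ge0.
  (* Chernoff on both sides, at distance [4 si] from the mean with parameter [1 / si]. The mass left
     in the middle is at least 1 - 1/3 - 1/4 = 5/12. *)
  have : (1 <= \sum_(m <oo) (mid m)%:E + (expR (- 2) + expR (- 3))%:E)%E.
    apply: (@le_trans _ _ (\sum_(m <oo) (mid m)%:E +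
       (\sum_(m <oo) (poisson_pmf mu m * expR (si^-1 * m%:R + - (si^-1 * x)))%:E +
        \sum_(m <oo) (poisson_pmf mu m * expR (- si^-1 * m%:R + si^-1 * y))%:E))%E).
      rewrite -(poisson_pmf_sum mu0) -nneseriesD; try by move=> *; rewrite lee_fin.
      rewrite -nneseriesD; first last.
      - by move=> m _ _; rewrite -EFinD lee_fin addr_ge0.
      - by move=> m _ _; rewrite lee_fin.
      apply: lee_nneseries => [m _ _|m _]; first by rewrite lee_fin poisson_pmf_ge0.
      rewrite -!EFinD lee_fin /mid.
      have p0 := poisson_pmf_ge0 mu m.
      have big w : 0 <= w -> poisson_pmf mu m <= poisson_pmf mu m * expR w.
        by move=> w0; rewrite ler_peMr// -[leLHS]expR0 ler_expR.
      have g1 := mgf si^-1 (- (si^-1 * x)) m.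
      have g2 := mgf (- si^-1) (si^-1 * y) m.
      have [mx|xm] /= := leP m%:R x; last first.
        have := big (si^-1 * m%:R + - (si^-1 * x)).
        have -> : 0 <= si^-1 * m%:R + - (si^-1 * x).
          by rewrite -mulrBr mulr_ge0//; [case/andP: vsi|rewrite subr_ge0 ltW].
        by move=> /(_ isT); lra.
      have [ym|my] /= := leP y m%:R; first by lra.
      have := big (- si^-1 * m%:R + si^-1 * y).
      have -> : 0 <= - si^-1 * m%:R + si^-1 * y.
        by rewrite mulNr addrC -mulrBr mulr_ge0//; [case/andP: vsi|rewrite subr_ge0 ltW].
      by move=> /(_ isT); lra.
    rewrite !poisson_mgf// leeD2l// -EFinD lee_fin lerD// ler_expR.
      apply: (@le_trans _ _ (mu * (si^-1 + 2 * si^-1 ^+ 2) - si^-1 * x)).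
        by rewrite lerD2r ler_pM2l//; have := expR_le_quadratic vsi; lra.
      rewrite /mu -si2; set s' := si^-1 in siV vsi *.
      rewrite (_ : _ - _ = - 4 * (si * s') + 2 * (si * s') ^+ 2 - 8 * (si * s') * s'); last by ring.
      by rewrite siV; case/andP: vsi; lra.
    apply: (@le_trans _ _ (mu * (- si^-1 + si^-1 ^+ 2) + si^-1 * y)).
      case/andP: vsi => v0 _.
      by rewrite lerD2r ler_pM2l//; have := expRN_le_quadratic v0; lra.
    rewrite /mu /y -si2; set s' := si^-1 in siV vsi *.
    rewrite (_ : _ + _ = - 4 * (si * s') + (si * s') ^+ 2 - 4 * (si * s') * s'); last by ring.
    by rewrite siV; case/andP: vsi; lra.
  case: (\sum_(m <oo) (mid m)%:E)%E => [r| |]; rewrite ?leey//.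
  by rewrite -EFinD !lee_fin; lra.
have tilt m : mid m * expR (- D) <= (if (x < m%:R)%R then 0 else poisson_pmf la m).
  rewrite /mid; have [mx|xm] /= := leP m%:R x; last by rewrite mul0r.
  have [ym|my] := leP y m%:R; last by rewrite mul0r poisson_pmf_ge0.
  rewrite expRN ler_pdivrMr ?expR_gt0//.
  apply: (le_trans (poisson_pmf_tilt m mu0 mula)).
  rewrite ler_wpM2l ?poisson_pmf_ge0// ler_expR ler_pdivrMr//.
  have h1 : 0 <= la - mu <= (K + 4) * si by rewrite /mu; apply/andP; split; rewrite -/si in laK; lra.
  have h2 : la - m%:R <= (K + 8) * si by rewrite -/si in laK; move: ym; rewrite /y; lra.
  apply: (@le_trans _ _ ((la - mu) * ((K + 8) * si))).
    by rewrite ler_wpM2l//; case/andP: h1.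
  apply: (@le_trans _ _ ((K + 4) * si * ((K + 8) * si))).
    by rewrite ler_wpM2r ?mulr_ge0 ?addr_ge0//; case/andP: h1.
  rewrite (_ : _ * _ * _ = D * si ^+ 2); last by rewrite /D; ring.
  by rewrite si2 ler_wpM2l.
have total : ((\sum_(m <oo) (if (x < m%:R)%R then (poisson_pmf la m)%:E else 0)) +
    (5 / 12 * expR (- D))%:E <= 1)%E.
  rewrite -(poisson_pmf_sum la0).
  apply: (@le_trans _ _ ((\sum_(m <oo) (if (x < m%:R)%R then (poisson_pmf la m)%:E else 0)) +
     \sum_(m <oo) (expR (- D))%:E * (mid m)%:E)%E).
    rewrite leeD2l// nneseriesZl; last by move=> m _; rewrite lee_fin.
    by rewrite mulrC EFinM lee_wpmul2l ?lee_fin ?expR_ge0.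
  rewrite -nneseriesD; first last.
  - by move=> m _ _; rewrite -EFinM lee_fin mulr_ge0 ?expR_ge0.
  - by move=> m _ _; case: ifP => // _; rewrite lee_fin poisson_pmf_ge0.
  apply: lee_nneseries => [m _ _|m _].
    apply: adde_ge0; first by case: ifP => // _; rewrite lee_fin poisson_pmf_ge0.
    by rewrite -EFinM lee_fin mulr_ge0 ?expR_ge0.
  have := tilt m; rewrite mulrC -EFinM.
  case: ifP => _ h; last by rewrite add0e lee_fin.
  by rewrite -EFinD lee_fin; lra.
move: total; case: (\sum_(m <oo) _)%E => [r| |] //.
by rewrite -EFinD !lee_fin; lra.
by move=> _; rewrite leNye.
Qed.

End Poisson.

(** * Events of the model and the law of the rates *)

Section Model.
Context {R : realType} {d : measure_display} {T : measurableType d}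
  {P : probability T R}.
Variables (F : R -> R) (rate : nat -> {RV P >-> R})
  (clock : nat -> R -> {RV P >-> nat}).
Hypothesis rates_iid : iid_with_df F rate.
Hypothesis clocks : poisson_clocks rate clock.

Let path (w : T) (k : nat) (s : R) : nat := clock k s w.

Lemma clock_counting_path k w : counting_path (clock k ^~ w).
Proof. by split; [exact: (clocks_0 clocks)|move=> *; exact: (clocks_nondecreasing clocks)]. Qed.

Lemma measurable_levels_clock k t : measurable_levels (clock k t).
Proof. by move=> m; exact: (@measurable_funPTI _ _ _ _ (clock k t) [set m]). Qed.

Lemma measurable_levels_xi k t : 0 <= t -> measurable_levels (fun w => xi (path w) k t).
Proof.
move=> t0; apply: (xi_measurable_right_continuous (M := clock) k _ _ _).1 => //.
- by move=> *; exact: measurable_levels_clock.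
- by move=> *; exact: clock_counting_path.
- by move=> *; exact: (clocks_right_continuous clocks).
Qed.


Lemma measurable_xi_le k t (x : R) : 0 <= t ->
  measurable [set w | (xi (path w) k t)%:~R <= x].
Proof.
move=> t0; rewrite (_ : [set _ | _] = \bigcup_n ([set w | xi (path w) k t = n%:Z - k%:Z] `&`
   [set w | (n%:Z - k%:Z)%:~R <= x])).
  apply: bigcupT_measurable => n; apply: measurableI; first exact: measurable_levels_xi.
  case: (boolP ((n%:Z - k%:Z)%:~R <= x)) => h.
    by rewrite (_ : [set _ | _] = setT)//; apply/seteqP; split.
  by rewrite (_ : [set _ | _] = set0)//; apply/seteqP; split => // w /=; rewrite (negPf h).
apply/seteqP; split=> w /=; last by case=> n _ /= [->].
move=> le_x; exists (absz (xi (path w) k t + k%:Z)) => //=.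
have e : xi (path w) k t = (absz (xi (path w) k t + k%:Z))%:Z - k%:Z.
  by have := xi_ge (path w) k t; lia.
by rewrite -e.
Qed.

Lemma measurable_beyond_le (c t x : R) : 0 <= t ->
  measurable [set w | (beyond c (path w) t <= x%:E)%E].
Proof.
move=> t0; have [x0|x0] := leP 0 x; last first.
  rewrite (_ : [set _ | _] = set0)//; apply/seteqP; split => // w /=.
  by rewrite /beyond ge_max lee_fin (lt_geF x0).
rewrite (_ : [set _ | _] = \bigcap_k ([set w | (xi (path w) k t)%:~R <= c * t] `|`
   [set w | k.+1%:R <= x])).
  apply: bigcapT_measurable => k; apply: measurableU; first exact: measurable_xi_le.
  case: (boolP (k.+1%:R <= x)) => h.
    by rewrite (_ : [set _ | _] = setT)//; apply/seteqP; split.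
  by rewrite (_ : [set _ | _] = set0)//; apply/seteqP; split.
apply/seteqP; split=> w /=.
  by move=> /(beyond_leP c t (path w) x0) H k _; exact: H.
by move=> H; apply/beyond_leP => // k; exact: H.
Qed.

Lemma measurable_beyond_ge (c t x : R) : 0 <= t ->
  measurable [set w | (x%:E <= beyond c (path w) t)%E].
Proof.
move=> t0; rewrite (_ : [set _ | _] =
  \bigcap_i ~` [set w | (beyond c (path w) t <= (x - i.+1%:R^-1)%:E)%E]).
  by apply: bigcapT_measurable => i; apply: measurableC; exact: measurable_beyond_le.
apply/seteqP; split=> w /=.
  move=> xb i _ /= /(le_trans xb); rewrite lee_fin leNgt ltrBlDr ltrDl.
  by rewrite invr_gt0 ltr0n.
move=> H; rewrite leNgt; apply/negP => bx.
have [y yb yx] : exists2 y, (beyond c (path w) t <= y%:E)%E & y < x.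
  move: bx; case: (beyond _ _ _) => [y yx||] //; first by exists y.
  by move=> _; exists (x - 1); rewrite ?leNye// ltrBlDr ltrDl.
have [i iy] : exists i, i.+1%:R^-1 < x - y.
  exists (Num.truncn (x - y)^-1); rewrite invf_plt ?posrE ?subr_gt0//.
  exact: truncnS_gt.
apply: (H i) => //=; apply: le_trans yb _.
by rewrite lee_fin lerBrDr addrC -lerBrDr ltW.
Qed.

Definition rates_above (n : nat) (x : R) : set T :=
  [set w | forall k, (k < n)%N -> x < rate k w].

Lemma rates_aboveE n x : rates_above n x = ~` \bigcup_k (if (k < n)%N
    then rate k @^-1` `]-oo, x] else set0).
Proof.
apply/seteqP; split=> w /=.
  move=> H [k _]; case: ifP => // kn /=; rewrite in_itv/= leNgt.
  by rewrite H.
move=> H k kn; rewrite ltNge; apply/negP => kx; apply: H; exists k => //.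
by rewrite kn /= in_itv/=.
Qed.

(** This makes [clocks_law] applicable on the event, since that law conditions on the rates
    alone. *)
Lemma sigma_rates_above n x : sigma_rates rate (rates_above n x).
Proof.
rewrite rates_aboveE.
  apply: sigma_algebraC; apply: sigma_algebra_bigcup => k; case: ifP => _.
    apply: sub_gen_smallest; exists k => //; exists `]-oo, x]%classic => //.
    by rewrite setTI.
  by have [] := smallest_sigma_algebra setT (\bigcup_k preimage_set_system setT (rate k) measurable).
Qed.

Lemma measurable_rate_le k x : measurable (rate k @^-1` `]-oo, x]).
Proof. exact: measurable_funPTI. Qed.

Lemma measurable_rates_above n x : measurable (rates_above n x).
Proof.
rewrite rates_aboveE.
  apply: measurableC; apply: bigcupT_measurable => k; case: ifP => // _.
  exact: measurable_rate_le.
Qed.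

Lemma prob_rate_le k x : P (rate k @^-1` `]-oo, x]) = (F x)%:E.
Proof. by rewrite -(rates_iid.2 k). Qed.

Lemma prob_not_rates_above n x : (P (~` rates_above n x) <= (n%:R * F x)%:E)%E.
Proof.
elim: n => [|n IH].
  rewrite (_ : ~` _ = set0) ?measure0 ?mul0r//.
  by apply/seteqP; split => // w /=; apply.
apply: (@le_trans _ _ (P (~` rates_above n x `|` rate n @^-1` `]-oo, x]))).
  apply: le_measure; rewrite ?inE.
  - by apply: measurableC; exact: measurable_rates_above.
  - apply: measurableU; last exact: measurable_rate_le.
    by apply: measurableC; exact: measurable_rates_above.
  - move=> w /= H; have [le_n|lt_n] := leP (rate n w) x; first by right; rewrite /= in_itv.
    left=> Hn; apply: H => k; rewrite ltnS leq_eqVlt => /predU1P[->//|]; exact: Hn.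
apply: (le_trans (measureU2 _ _ _)).
- by apply: measurableC; exact: measurable_rates_above.
- exact: measurable_rate_le.
rewrite -natr1 mulrDl mul1r EFinD leeD// -(prob_rate_le n x).
exact: lexx.
Qed.

(** Each factor equals [1 - de] plus [de] times the indicator of [x < rate k]. Expanding it either
    drops [k] or moves it from [s1] to [s2], so that independence, given for intersections of
    events, is enough; the list [s2] is there for this induction. *)
Lemma integral_prod_rates (x de : R) (s1 s2 : seq nat) : uniq (s1 ++ s2) ->
  0 <= de <= 1 ->
  (\int[P]_(w in \bigcap_(k in [set` s2]) (rate k @^-1` `]x, +oo[))
     (\prod_(k <- s1) (if (x < rate k w)%R then 1 else 1 - de)%R)%:E)%E =
  ((1 - de * F x) ^+ size s1 * (1 - F x) ^+ size s2)%:E.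
Proof.
move=> us /andP[de0 de1].
have mU k : measurable (rate k @^-1` `]x, +oo[) by exact: measurable_funPTI.
have PU k : P (rate k @^-1` `]x, +oo[) = (1 - F x)%:E.
  rewrite (_ : _ @^-1` _ = ~` (rate k @^-1` `]-oo, x])).
    rewrite probability_setC; last exact: measurable_rate_le.
    by rewrite prob_rate_le.
  apply/seteqP; split=> w /=; rewrite !in_itv/= andbT ltNge; first by move/negP.
  by move=> /negP.
elim: s1 s2 us => [|k s1 IH] s2 us.
  under eq_integral do rewrite big_nil.
  have mC : measurable (\bigcap_(k in [set` s2]) (rate k @^-1` `]x, +oo[)).
    by apply: fin_bigcap_measurable.
  rewrite integral_cst// mul1e expr0 mul1r.
  etransitivity; first exact: (rates_iid.1 s2 (fun=> `]x, +oo[%classic)).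
  under eq_bigr do rewrite PU.
  elim: {us mC} s2 => [|j s2 IH]; first by rewrite big_nil.
  by rewrite big_cons IH exprS EFinM.
have kE (s : seq nat) : \bigcap_(j in [set` k :: s]) (rate j @^-1` `]x, +oo[) =
    \bigcap_(j in [set` s]) (rate j @^-1` `]x, +oo[) `&` rate k @^-1` `]x, +oo[.
  apply/seteqP; split=> w /= H.
    by split=> [j /= js|]; apply: H; rewrite /= inE ?eqxx ?js ?orbT.
  by move=> j /=; rewrite inE => /predU1P[->|/H.1]; [exact: H.2|].
pose C := \bigcap_(j in [set` s2]) (rate j @^-1` `]x, +oo[).
have mC : measurable C by apply: fin_bigcap_measurable.
pose Pi w : R := \prod_(j <- s1) (if x < rate j w then 1 else 1 - de).
have Pi0 w : 0 <= Pi w.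
  by apply: prodr_ge0 => j _; case: ifP; rewrite // subr_ge0.
have mPi : measurable_fun setT Pi.
  apply: measurable_prod => j _; apply: measurable_fun_if => //.
  exact: measurable_fun_ltr.
have IH1 : (\int[P]_(w in C) (Pi w)%:E =
    ((1 - de * F x) ^+ size s1 * (1 - F x) ^+ size s2)%:E)%E.
  by apply: IH; move: us => /= /andP[].
have IH2 : (\int[P]_(w in C `&` rate k @^-1` `]x, +oo[) (Pi w)%:E =
    ((1 - de * F x) ^+ size s1 * (1 - F x) ^+ (size s2).+1)%:E)%E.
  rewrite -kE; apply: (IH (k :: s2)).
  by move: us; rewrite -(uniq_catCA [:: k] s1 s2).
transitivity (\int[P]_(w in C) ((1 - de)%:E * (Pi w)%:E +
    de%:E * ((fun v => (Pi v)%:E) \_ (rate k @^-1` `]x, +oo[)) w))%E.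
  apply: eq_integral => w _; rewrite big_cons /patch.
  have -> : (w \in rate k @^-1` `]x, +oo[) = (x < rate k w).
    by apply/idP/idP; rewrite inE /= in_itv/= andbT.
  by case: ifP => _; rewrite -!EFinM -EFinD; congr (_%:E); rewrite /Pi; ring.
have mPiE : measurable_fun C (EFin \o Pi).
  by apply/measurable_EFinP; exact: measurable_funTS.
have mpatch : measurable_fun C ((fun v => (Pi v)%:E) \_ (rate k @^-1` `]x, +oo[)).
  apply: measurable_funTS; apply/(measurable_restrictT _ _).1 => //.
  by apply/measurable_EFinP; exact: measurable_funTS.
have patch0 w : (0 <= ((fun v => (Pi v)%:E) \_ (rate k @^-1` `]x, +oo[)) w)%E.
  by rewrite /patch; case: ifP => // _; rewrite lee_fin.
have de1' : (0 <= (1 - de)%:E)%E by rewrite lee_fin subr_ge0.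
rewrite ge0_integralD//; first last.
- exact: measurable_funeM.
- by move=> w _; rewrite mule_ge0 ?lee_fin.
- exact: measurable_funeM.
- by move=> w _; rewrite mule_ge0 ?lee_fin.
rewrite ge0_integralZl//; last by move=> w _; rewrite lee_fin.
rewrite ge0_integralZl//.
rewrite -integral_mkcondr IH1 IH2 -!EFinM -EFinD; congr (_%:E).
by rewrite /= !exprS; ring.
Qed.

End Model.

(** * Joint law of the clock increments given the rates *)

Section Increments.
Context {R : realType} {d : measure_display} {T : measurableType d}
  {P : probability T R}.

Lemma pmf_seq_iota (p : nat -> nat -> R) s N (v : seq nat) : size v = N ->
  pmf_seq [seq p i | i <- iota s N] v = \prod_(0 <= i < N) p (s + i)%N (nth 0%N v i).
Proof.
elim: N s v => [|N IH] s v; first by move=> /size0nil ->; rewrite big_geq.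
case: v => [//|x v] /= [sv]; rewrite big_nat_recl// addn0; congr (_ * _).
by rewrite IH//; apply: eq_bigr => i _; rewrite addSnnS.
Qed.

Lemma prod_divn_modn (G : nat -> nat -> R) n J : (0 < J)%N ->
  \prod_(k <- iota 0 n) \prod_(j < J) G k j =
  \prod_(0 <= i < n * J) G (i %/ J)%N (i %% J)%N.
Proof.
move=> J0; rewrite (_ : iota 0 n = index_iota 0 n); last by rewrite /index_iota subn0.
elim: n => [|n IH]; first by rewrite !big_geq.
rewrite big_nat_recr//= IH mulSn addnC [RHS](big_cat_nat (n := (n * J)%N))//= ?leq_addr//.
congr (_ * _).
have -> : \prod_(n * J <= i < n * J + J) G (i %/ J)%N (i %% J)%N =
    \prod_(j < J) G ((j + n * J) %/ J)%N ((j + n * J) %% J)%N.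
  by rewrite -{1}[(n * J)%N]add0n big_addn addKn big_mkord.
apply: eq_bigr => j _; rewrite addnC divnMDl// modnMDl divn_small// addn0.
by rewrite modn_small.
Qed.

Variables (rate : nat -> {RV P >-> R}) (clock : nat -> R -> {RV P >-> nat}).
Hypothesis clocks : poisson_clocks rate clock.

(** The pair (particle [k], cell [j]) is coded by [i = k * J + j], the order in which [tandem] reads
    the services. The subtraction is exact at ordered nonnegative times because the clocks are
    nondecreasing. *)
Definition increment (J : nat) (tm : nat -> R) (i : nat) (w : T) : nat :=
  (clock (i %/ J) (tm (i %% J).+1) w - clock (i %/ J) (tm (i %% J)%N) w)%N.

Definition increment_pmf (J : nat) (tm : nat -> R) (i : nat) (w : T) : nat -> R :=
  poisson_pmf (rate (i %/ J)%N w * (tm (i %% J).+1 - tm (i %% J)%N)).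

Lemma measurable_levels_increment J tm i : measurable_levels (increment J tm i).
Proof.
move=> m; rewrite (_ : [set _ | _] = \bigcup_a \bigcup_b
  (if (a - b == m)%N then [set w | clock (i %/ J) (tm (i %% J).+1) w = a] `&`
     [set w | clock (i %/ J) (tm (i %% J)%N) w = b] else set0)).
  apply: bigcupT_measurable => a; apply: bigcupT_measurable => b.
  by case: ifP => // _; apply: measurableI; exact: measurable_levels_clock.
apply/seteqP; split=> w /=.
  move=> e; exists (clock (i %/ J) (tm (i %% J).+1) w) => //.
  by exists (clock (i %/ J) (tm (i %% J)%N) w) => //; rewrite -e eqxx.
by move=> [a _ [b _]]; case: ifP => // /eqP <- [/= <- <-].
Qed.

Lemma measurable_increment_pmf J tm i m :
  measurable_fun setT (fun w => increment_pmf J tm i w m).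
Proof.
apply: (measurableT_comp (measurable_poisson_pmf m measurableT)).
by apply: measurable_funM.
Qed.

(** [clocks_law] provides the point masses of the increments given the rates, and [prob_map_levels]
    passes from these to every event [g]. *)
Lemma prob_increments (A : set T) n J (tm : nat -> R) :
  sigma_rates rate A -> measurable A -> (0 < J)%N -> 0 <= tm 0%N ->
  (forall j, tm j < tm j.+1) ->
  forall g : seq nat -> bool,
  P (A `&` [set w | g [seq increment J tm i w | i <- iota 0 (n * J)]]) =
  (\int[P]_(w in A) prob_seq [seq increment_pmf J tm i w | i <- iota 0 (n * J)] g)%E.
Proof.
move=> sA mA J0 tm0 tmS g.
have tm_ge0 j : 0 <= tm j by elim: j => // j IH; apply: le_trans IH (ltW (tmS j)).
rewrite (prob_map_levels (P := P) (p := increment_pmf J tm) _ _ _ mA mA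
  (phi := fun=> 1)).
- by apply: eq_integral => w _; rewrite mul1e.
- exact: measurable_levels_increment.
- by move=> i w m; exact: poisson_pmf_ge0.
- exact: measurable_increment_pmf.
- exact: measurable_cst.
- by [].
move=> v; rewrite size_iota => sv.
have law := @clocks_law _ _ _ _ _ _ clocks A (iota 0 n) J tm
  (fun k j => nth 0%N v (k * J + j)) sA (iota_uniq 0 n) tm0 (fun j _ => tmS j).
rewrite [X in A `&` X](_ : _ = [set w | forall k j, k \in iota 0 n -> (j < J)%N ->
  clock k (tm j.+1) w = (clock k (tm j) w + nth 0%N v (k * J + j))%N]).
  rewrite law; apply: eq_integral => w _; rewrite mul1r pmf_seq_iota//.
  rewrite (prod_divn_modn (fun k j => poisson_pmf (rate k w * (tm j.+1 - tm j)) (nth 0%N v (k * J + j))))//.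
  by congr (_%:E); apply: eq_bigr => i _; rewrite add0n -divn_eq.
apply/seteqP; split=> w /=.
  move=> <- k j; rewrite mem_iota add0n /= => kn jJ.
  have kj : (k * J + j < n * J)%N.
    apply: (@leq_trans (k.+1 * J)); first by rewrite mulSn addnC ltn_add2r.
    by rewrite leq_mul2r kn orbT.
  rewrite (nth_map 0%N) ?size_iota// nth_iota// add0n /increment.
  rewrite divnMDl// modnMDl divn_small// addn0 modn_small// subnKC//.
  exact/(clocks_nondecreasing clocks)/ltW.
move=> H; apply: (@eq_from_nth _ 0%N); first by rewrite size_map size_iota.
move=> i; rewrite size_map size_iota => iN.
rewrite (nth_map 0%N) ?size_iota// nth_iota// add0n /increment H.
- by rewrite addKn -divn_eq.
- by rewrite mem_iota add0n /= ltn_divLR.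
- by rewrite ltn_mod.
Qed.

End Increments.

(** * Annealed bounds for clocks and particles *)

Section ProbabilityBounds.
Context {R : realType} {d : measure_display} {T : measurableType d}
  {P : probability T R}.
Variables (F : R -> R) (rate : nat -> {RV P >-> R})
  (clock : nat -> R -> {RV P >-> nat}).
Hypothesis rates_iid : iid_with_df F rate.
Hypothesis clocks : poisson_clocks rate clock.

Lemma df_ge0 x : 0 <= F x.
Proof. by rewrite -lee_fin -(prob_rate_le rates_iid 0 x). Qed.

Lemma df_le1 x : F x <= 1.
Proof.
by rewrite -lee_fin -(prob_rate_le rates_iid 0 x) probability_le1//; exact: measurable_rate_le.
Qed.

Lemma prob_le_rates_above n x (E : set T) : measurable E ->
  (P E <= (n%:R * F x)%:E + P (rates_above rate n x `&` E))%E.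
Proof.
move=> mE; have mA := measurable_rates_above rate n x.
apply: (@le_trans _ _ (P (~` rates_above rate n x `|` rates_above rate n x `&` E))).
  apply: le_measure; rewrite ?inE//.
    by apply: measurableU; [exact: measurableC|exact: measurableI].
  by move=> w Ew; have [Aw|nAw] := pselect (rates_above rate n x w); [right|left].
apply: (le_trans (measureU2 _ _ _)).
- exact: measurableC.
- exact: measurableI.
by rewrite leeD2r//; exact: (prob_not_rates_above rates_iid).
Qed.

(** Given the rates, the clocks at time [t] are independent: a rate in (c, x] contributes a factor
    at most [1 - de], a larger one at most 1. Restricting to rates above [c] costs nothing since
    [F c = 0], and makes the Poisson parameters positive. *)
Lemma prob_all_clocks_gt (c x de t : R) n : F c = 0 -> 0 < c -> 0 < t -> 0 <= de <= 1 ->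
  (forall p, c < p -> p <= x ->
    (\sum_(m <oo) (if (c * t < m%:R)%R then (poisson_pmf (p * t) m)%:E else 0)
       <= (1 - de)%:E)%E) ->
  (P [set w | forall k, (k < n)%N -> (c * t < (clock k t w)%:R)%R] <=
    ((1 - de * F x) ^+ n)%:E)%E.
Proof.
move=> Fc c0 t0 de01 tail; set E := [set w | _].
pose tm (j : nat) : R := j%:R * t.
have tmS j : tm j < tm j.+1 by rewrite ltr_pM2r// ltr_nat.
pose a (m : nat) := (c * t < m%:R).
have incE k w : increment clock 1 tm k w = clock k t w.
  by rewrite /increment divn1 modn1 /tm mul1r mul0r (clocks_0 clocks) subn0.
have EE : E = [set w | all a [seq increment clock 1 tm i w | i <- iota 0 (n * 1)]].
  apply/seteqP; split=> w /=; rewrite muln1 all_map.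
    by move=> Ew; apply/allP => k; rewrite mem_iota add0n /= => kn; rewrite incE; exact: Ew.
  by move=> /allP Ew k kn; have := Ew k; rewrite mem_iota /= add0n incE; apply.
have mE : measurable E.
  by rewrite EE; apply: measurable_map_levels; exact: measurable_levels_increment.
have mA := measurable_rates_above rate n c.
apply: (le_trans (prob_le_rates_above n c mE)).
rewrite Fc mulr0 add0e EE (prob_increments clocks)//; last first.
- by rewrite /tm mul0r.
- exact: sigma_rates_above.
pose u k w : R := if x < rate k w then 1 else 1 - de.
have [de0 de1] := andP de01.
have u0 k w : 0 <= u k w by rewrite /u; case: ifP; rewrite // subr_ge0.
have mu D : measurable D -> measurable_fun D (fun w => (\prod_(k <- iota 0 n) u k w)%:E).
  move=> mD; apply/measurable_EFinP; apply: measurable_funTS.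
  by apply: measurable_prod => k _; apply: measurable_fun_if => //; exact: measurable_fun_ltr.
apply: (@le_trans _ _ (\int[P]_(w in rates_above rate n c) (\prod_(k <- iota 0 n) u k w)%:E)%E).
  apply: ge0_le_integral => //.
  - by move=> w _; apply: prob_seq_ge0 => i m; exact: poisson_pmf_ge0.
  - apply: measurable_funTS; apply: (measurable_prob_seq (p := increment_pmf rate 1 tm)).
      by move=> *; exact: poisson_pmf_ge0.
    exact: measurable_increment_pmf.
  - exact: mu.
  move=> w Aw; rewrite muln1; apply: (prob_seq_all_le (u := u ^~ w)) => //.
    by move=> *; exact: poisson_pmf_ge0.
  move=> k; rewrite mem_iota add0n /= => kn; have ck := Aw k kn.
  rewrite /increment_pmf divn1 modn1 /tm mul1r mul0r subr0 /u.
  case: ltP => [_|kx]; last exact: tail.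
  rewrite -(@poisson_pmf_sum _ (rate k w * t)) ?mulr_gt0 ?(lt_trans c0 ck)//.
  by apply: lee_nneseries => [m _ _|m _]; case: ifP => // _; rewrite lee_fin poisson_pmf_ge0.
apply: (@le_trans _ _ (\int[P]_w (\prod_(k <- iota 0 n) u k w)%:E)%E).
  apply: ge0_subset_integral => //; first exact: mu.
  by move=> w _; rewrite lee_fin prodr_ge0.
have := @integral_prod_rates _ _ _ P F rate rates_iid x de (iota 0 n) [::].
rewrite cats0 iota_uniq size_iota expr0 mulr1 => /(_ isT de01).
rewrite (_ : \bigcap_(k in _) _ = setT); last by apply/seteqP; split.
by move=> ->.
Qed.

(** [be] is the probability that a clock of rate [x] rings within a cell of length [t / J]. The
    first term pays for a rate at most [x] among the [n] particles; on the remaining event every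
    cell is at least as likely to contain a ring. *)
Lemma prob_xi_le (x al t h ct : R) n J :
  let be := 1 - expR (- (x * (t / J%:R))) in
  (0 < n)%N -> (0 < J)%N -> 0 < t -> 0 < x -> 0 < h -> 0 < al -> al < be ->
  (P [set w | ((xi (fun k s => clock k s w) n.-1 t)%:~R <= ct)%R] <=
   (n%:R * F x + (bernoulli_sum al J (fun v => ((count id v)%:R <= ct + n%:R + h)%R%:R)
     + n%:R * (al * (1 - al) / (be - al)) / h))%:E)%E.
Proof.
move=> be n0 J0 t0 x0 h0 al0 albe; set E := [set w | _].
pose tau := t / J%:R; have tau0 : 0 < tau by rewrite divr_gt0// ltr0n.
pose tm (j : nat) : R := j%:R * tau.
have tmS j : tm j < tm j.+1 by rewrite ltr_pM2r// ltr_nat.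
have Jtau : J%:R * tau = t by rewrite mulrC divfK// pnatr_eq0 -lt0n.
have be1 : be < 1 by rewrite gtrBl expR_gt0.
have be01 : 0 <= be <= 1 by rewrite !ltW// (lt_trans al0).
have mE : measurable E by apply: (measurable_xi_le clocks); exact: ltW.
have mA := measurable_rates_above rate n x.
apply: (le_trans (prob_le_rates_above n x mE)); rewrite EFinD leeD2l//.
have PfinE : P (rates_above rate n x `&` E) \is a fin_num.
  by apply: fin_num_measure; exact: measurableI.
rewrite -(fineK PfinE) lee_fin; apply: (stationary_tandem_bound al0 albe be1 h0).
  by rewrite fine_ge0.
move=> Q a sQ sa; rewrite -lee_fin fineK//.
pose bad s := (1 - n%:Z - (sumn Q)%:Z + (count id (tandem J Q a s))%:Z)%:~R <= ct.
(* [bad] is not shown to be decreasing in the services. Asking for it at every pointwise smaller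
   word is decreasing by construction, and still follows from the particle being late, because
   [xi_ge_tandem] requires a ring only where a service is offered. *)
pose g s := `[< forall s', size s' = size s ->
  (forall i, nth false s' i -> nth false s i) -> bad s' >].
pose word w := [seq increment clock J tm i w | i <- iota 0 (n * J)].
have mg : measurable [set w | g [seq (0 < m)%N | m <- word w]].
  apply: (@measurable_map_levels _ _ _ (increment clock J tm) _ _
    (fun v => g [seq (0 < m)%N | m <- v])).
  exact: measurable_levels_increment.
apply: (@le_trans _ _ (P (rates_above rate n x `&` [set w | g [seq (0 < m)%N | m <- word w]]))).
  apply: le_measure; rewrite ?inE; [exact: measurableI|exact: measurableI|].
  move=> w [Aw /= Ew]; split=> //=; apply/asboolP => s'; rewrite !size_map size_iota => ss' s'w.
  apply: le_trans Ew; rewrite ler_int -Jtau -sQ.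
  (* Label 0 follows a virtual leader started at site 1, so the particle of index [n.-1] comes after
     [n] queues. *)
  apply: (xi_ge_tandem (M := fun k s => clock k s w) _ (ltW tau0) (k := 0) sa) => //.
  - by move=> k; exact: (clock_counting_path clocks).
  - by rewrite sQ.
  - move=> i j; rewrite sQ => iQ jJ /s'w.
    have ijN : (i * J + j < n * J)%N.
      apply: (@leq_trans (i.+1 * J)); first by rewrite mulSn addnC ltn_add2r.
      by rewrite leq_mul2r iQ orbT.
    rewrite (nth_map 0%N) ?size_map ?size_iota// (nth_map 0%N) ?size_iota// nth_iota//.
    rewrite add0n /increment divnMDl// modnMDl divn_small// addn0 modn_small// subn_gt0.
    by rewrite add0n.
  - by rewrite sQ prednK.
have tm0 : 0 <= tm 0%N by rewrite /tm mul0r.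
rewrite (prob_increments clocks n (@sigma_rates_above _ _ _ _ rate n x) mA J0 tm0 tmS
  (fun v => g [seq (0 < m)%N | m <- v])).
set B := bernoulli_sum be (n * J) _.
have B0 : 0 <= B by apply: word_sum_ge0 => [b|v]; [exact: bernoulli_weight_ge0|rewrite ler0n].
apply: (@le_trans _ _ (\int[P]_(w in rates_above rate n x) (cst B%:E w))%E).
  apply: ge0_le_integral => //.
  - by move=> w _; apply: prob_seq_ge0 => i m; exact: poisson_pmf_ge0.
  - apply: measurable_funTS; apply: (measurable_prob_seq (p := increment_pmf rate J tm)).
      by move=> *; exact: poisson_pmf_ge0.
    exact: measurable_increment_pmf.
  move=> w Aw.
  have rate_x i : i \in iota 0 (n * J) -> x * tau <= rate (i %/ J)%N w * (tm (i %% J).+1 - tm (i %% J)%N).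
    rewrite mem_iota add0n /= => iN; rewrite /tm -mulrBl -natr1 addrAC subrr add0r mul1r.
    by rewrite ler_pM2r// ltW// Aw// ltn_divLR.
  have rate_gt0 i : i \in iota 0 (n * J) -> 0 < rate (i %/ J)%N w * (tm (i %% J).+1 - tm (i %% J)%N).
    by move=> /rate_x; apply: lt_le_trans; rewrite mulr_gt0.
  apply: (le_trans (prob_seq_le_bernoulli (g := g) be01 _ _ _ _)).
  - by move=> *; exact: poisson_pmf_ge0.
  - by move=> i iN; apply: poisson_pmf_sum; exact: rate_gt0.
  - move=> i iN; rewrite /increment_pmf poisson_pmf0; last exact: rate_gt0.
    by rewrite /be subKr ler_expR lerN2; exact: rate_x.
  - move=> u v suv uv /asboolP gv; apply/asboolP => s' ss' s'u.
    by apply: gv; [rewrite ss'|move=> i /s'u /uv].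
  rewrite size_iota lee_fin; apply: ler_word_sum => [b|s _].
    exact: bernoulli_weight_ge0.
  rewrite ler_nat -/(bad s); case: (boolP (g s)) => // /asboolP gs.
  by rewrite gs.
rewrite integral_cst// -[leRHS]mule1 lee_wpmul2l ?lee_fin//.
exact: probability_le1.
Qed.

End ProbabilityBounds.

(** * Quantitative form of both bounds *)

Section Estimates.
Context {R : realType} {d : measure_display} {T : measurableType d}
  {P : probability T R}.
Variables (F : R -> R) (rate : nat -> {RV P >-> R})
  (clock : nat -> R -> {RV P >-> nat}).
Hypothesis rates_iid : iid_with_df F rate.
Hypothesis clocks : poisson_clocks rate clock.

Let path (w : T) (k : nat) (s : R) : nat := clock k s w.

Lemma prob_ge_of_compl (G E : set T) (e : R) : measurable G -> measurable E ->
  ~` G `<=` E -> (P E <= e%:E)%E -> ((1 - e)%:E <= P G)%E.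
Proof.
move=> mG mE GE PE; have : (P (~` G) <= e%:E)%E.
  by apply: le_trans PE; apply: le_measure; rewrite ?inE//; exact: measurableC.
rewrite probability_setC//; have : P G \is a fin_num by exact: fin_num_measure.
by case: (P G) => // r _; rewrite -EFinB !lee_fin; lra.
Qed.

Lemma measurable_all_clocks_gt (x t : R) n :
  measurable [set w | forall k, (k < n)%N -> (x < (clock k t w)%:R)%R].
Proof.
rewrite (_ : [set _ | _] = \bigcap_k [set w | (k < n)%N -> x < (clock k t w)%:R]).
  apply: bigcapT_measurable => k; case: (ltnP k n) => kn.
    rewrite (_ : [set _ | _] = clock k t @^-1` [set m | x < m%:R]).
      exact: measurable_funPTI.
    by apply/seteqP; split=> w /=; [apply|].
  by rewrite (_ : [set _ | _] = setT)//; apply/seteqP; split.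
by apply/seteqP; split=> w /= H; [move=> k _; exact: H|move=> k; exact: H].
Qed.

Lemma prob_beyond_le (c x t e : R) n : 0 <= t -> 0 <= x -> n%:R <= x ->
  (P [set w | forall k, (k < n)%N -> (c * t < (clock k t w)%:R)%R] <= e%:E)%E ->
  ((1 - e)%:E <= P [set w | (beyond c (path w) t <= x%:E)%E])%E.
Proof.
move=> t0 x0 nx; apply: prob_ge_of_compl.
- exact: (measurable_beyond_le clocks).
- exact: measurable_all_clocks_gt.
move=> w /= nb k kn; rewrite ltNge; apply/negP => ck; apply: nb.
apply/beyond_leP => // l; have [lk|kl] := ltnP l k.
  by right; apply: le_trans nx; rewrite ler_nat (leq_trans lk)// ltnW.
left; apply: le_trans ck; rewrite -[leRHS]/((clock k t w)%:Z%:~R) ler_int.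
apply: le_trans (xi_le (path w) k t); apply: xi_anti => // j.
exact: (clock_counting_path clocks).
Qed.

Lemma prob_le_beyond (c x t e : R) n : 0 <= t -> x <= n%:R -> (0 < n)%N ->
  (P [set w | ((xi (path w) n.-1 t)%:~R <= c * t)%R] <= e%:E)%E ->
  ((1 - e)%:E <= P [set w | (x%:E <= beyond c (path w) t)%E])%E.
Proof.
move=> t0 xn n0; apply: prob_ge_of_compl.
- exact: (measurable_beyond_ge clocks).
- exact: (measurable_xi_le clocks).
move=> w /= nb; rewrite leNgt; apply/negP => ck; apply: nb.
by apply: le_beyond ck _; rewrite prednK.
Qed.

Lemma expRN_le_inv (z : R) : 0 < z -> expR (- z) <= z^-1.
Proof.
move=> z0; rewrite expRN lef_pV2 ?posrE ?expR_gt0//.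
by apply: le_trans (expR_ge1Dx z); rewrite lerDr.
Qed.

Lemma expRN_le_div (x y : R) : 0 < x -> 0 < y -> expR (- (x / y)) <= y / x.
Proof. by move=> x0 y0; rewrite -[leRHS]invf_div; apply: expRN_le_inv; rewrite divr_gt0. Qed.

(** The constants add up three losses: [2 kappa] for a slow rate, [1152 c] for the deviation of the
    Bernoulli walk, [48 c] for the gaps. The first and the last are proportional to [n], and n <= a
    s + 1 with s = eta^2 t spreads them over the two terms. *)
Lemma prob_slow_particle (c kappa a t eta : R) (n := (Num.truncn (a * (eta ^+ 2 * t))).+1) :
  0 < c -> 0 < kappa -> 0 < a -> 0 < t -> 0 < eta -> eta <= c ->
  8 * (a * eta) <= 1 -> 8 <= eta * t ->
  F (c + eta) <= 2 * kappa / (eta ^+ 2 * t) ->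
  (P [set w | ((xi (path w) n.-1 t)%:~R <= c * t)%R] <=
   ((2 * kappa + 48 * c) * a + (2 * kappa + 1200 * c) / (eta ^+ 2 * t))%:E)%E.
Proof.
move=> c0 kappa0 a0 t0 eta0 etac aeta etat Fle; set s := eta ^+ 2 * t in n Fle *.
have s0 : 0 < s by rewrite mulr_gt0 ?exprn_gt0.
have n_le : n%:R <= a * s + 1.
  by rewrite -natr1 lerD2r truncn_le mulr_ge0// ltW.
pose x := c + eta; have x0 : 0 < x by rewrite addr_gt0.
(* The mesh ensures 4 x^2 tau <= eta, so that be >= x tau - (x tau)^2 leaves a margin eta tau / 4
   over [al]. *)
pose J := (Num.truncn (4 * x ^+ 2 * t / eta)).+1.
have J0 : 0 < J%:R :> R by rewrite ltr0n.
have J_ge : 4 * x ^+ 2 * t / eta <= J%:R by apply/ltW/truncnS_gt.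
pose tau := t / J%:R; have tau0 : 0 < tau by rewrite divr_gt0.
have Jtau : J%:R * tau = t by rewrite mulrC divfK// gt_eqF.
have tau_le : 4 * (x ^+ 2 * tau) <= eta.
  have : 4 * x ^+ 2 * t <= eta * J%:R by rewrite [leRHS]mulrC -ler_pdivrMr.
  by rewrite /tau !mulrA ler_pdivrMr.
pose al := (c + eta / 2) * tau; pose be := 1 - expR (- (x * tau)).
have al0 : 0 < al by rewrite mulr_gt0// addr_gt0// divr_gt0.
have be_al : eta * tau / 4 <= be - al.
  have xt0 : 0 <= x * tau by rewrite mulr_ge0 ?ltW.
  have := expRN_le_quadratic xt0; rewrite /be /al exprMn => h.
  have : 4 * (x ^+ 2 * tau) * tau <= eta * tau by rewrite ler_wpM2r// ltW.
  by rewrite /x in h *; lra.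
have et0 : 0 < eta * tau by rewrite mulr_gt0.
have albe : al < be by rewrite -subr_gt0; lra.
have al1 : al <= 1.
  have : be <= 1 by rewrite gerBl expR_ge0.
  lra.
(* The gain [eta t / 2] is split exactly: [n] takes at most a quarter of [eta t], the gaps [h] a
   sixth, and the deviation [y] a twelfth. *)
pose h := eta * t / 6; have h0 : 0 < h by rewrite divr_gt0// mulr_gt0.
pose y := eta * t / 12; have y0 : 0 <= y by rewrite divr_ge0// mulr_ge0// ltW.
have := prob_xi_le (n := n) (J := J) rates_iid clocks (c * t) isT isT t0 x0 h0 al0 albe.
move=> /le_trans; apply.
rewrite lee_fin.
have Jal : J%:R * al = (c + eta / 2) * t by rewrite /al mulrCA Jtau.
have term1 : n%:R * F x <= 2 * kappa * a + 2 * kappa / s.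
  apply: (@le_trans _ _ ((a * s + 1) * (2 * kappa / s))).
    by apply: ler_pM; rewrite ?(df_ge0 rates_iid).
  by rewrite le_eqVlt; apply/orP; left; apply/eqP; field; rewrite gt_eqF.
have as_le : a * s <= eta * t / 8.
  rewrite /s (_ : a * _ = (8 * (a * eta)) * (eta * t / 8)); last by field.
  by rewrite ler_piMl// divr_ge0// mulr_ge0// ltW.
have term2 : bernoulli_sum al J (fun v => ((count id v)%:R <= c * t + n%:R + h)%R%:R)
    <= 1152 * c / s.
  apply: (@le_trans _ _ (bernoulli_sum al J (fun v => ((count id v)%:R <= J%:R * al - y)%R%:R))).
    apply: ler_word_sum => [b|v _]; first by apply: bernoulli_weight_ge0; rewrite ltW.
    rewrite ler_nat; case: (boolP (_ <= c * t + _ + _)) => // cv.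
    have -> // : (count id v)%:R <= J%:R * al - y.
    apply: (le_trans cv); rewrite Jal /h /y; lra.
  apply: (@le_trans _ _ (expR (- (y ^+ 2 / (4 * (J%:R * al)))))).
    by apply: bernoulli_sum_count_le; rewrite ?al0.
  apply: (@le_trans _ _ (expR (- (s / (1152 * c))))); last first.
    by apply: expRN_le_div s0 _; rewrite mulr_gt0 ?ltr0n.
  rewrite ler_expR lerN2 Jal /y /s.
  have ce : 0 < c + eta / 2 by rewrite addr_gt0// divr_gt0.
  rewrite (_ : (eta * t / 12) ^+ 2 / _ = eta ^+ 2 * t * (576 * (c + eta / 2))^-1); last first.
    by field; rewrite !gt_eqF//; lra.
  have k1 : 0 < 576 * (c + eta / 2) by rewrite mulr_gt0 ?ltr0n.
  have k2 : 0 < 1152 * c by rewrite mulr_gt0 ?ltr0n.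
  have k12 : 576 * (c + eta / 2) <= 1152 * c by lra.
  apply: ler_wpM2l; first exact: ltW s0.
  by rewrite lef_pV2 ?posrE.
have term3 : n%:R * (al * (1 - al) / (be - al)) / h <= 48 * c * a + 48 * c / s.
  (* The mean gap is at most [2 c tau] divided by [eta tau / 4], that is [8 c / eta]. *)
  apply: (@le_trans _ _ ((a * s + 1) * (8 * c / eta) / h)).
    rewrite ler_wpM2r ?invr_ge0 ?(ltW h0)//; apply: ler_pM => //.
      apply: divr_ge0; last by rewrite subr_ge0 ltW.
      by rewrite mulr_ge0 ?subr_ge0 ?(ltW al0).
    rewrite ler_pdivrMr ?subr_gt0//.
    apply: (@le_trans _ _ (2 * c * tau)).
      apply: (@le_trans _ _ al).
        by rewrite ler_piMr ?(ltW al0)// gerBl ltW.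
      apply: ler_wpM2r; [exact: ltW|lra].
    apply: (@le_trans _ _ (8 * c / eta * (eta * tau / 4))); last first.
      apply: ler_wpM2l => //; apply: divr_ge0; last exact: ltW.
      by rewrite mulr_ge0 ?(ltW c0).
    by rewrite le_eqVlt; apply/orP; left; apply/eqP; field; rewrite gt_eqF.
  rewrite le_eqVlt; apply/orP; left; apply/eqP.
  by rewrite /h /s; field; rewrite !gt_eqF.
rewrite -/x -/tau -/be (_ : (2 * kappa + 48 * c) * a + (2 * kappa + 1200 * c) / s =
  (2 * kappa * a + 2 * kappa / s) + (1152 * c / s + (48 * c * a + 48 * c / s))); last first.
  by field; rewrite gt_eqF.
by rewrite lerD// lerD.
Qed.

End Estimates.

(** * Asymptotics in [t] and choice of the thresholds *)

Lemma near_powR_ge {R : realType} (p M : R) : 0 < p -> \forall t \near +oo, M <= t `^ p.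
Proof.
move=> p0; near=> t.
have t0 : (Num.max M 0) `^ p^-1 <= t by near: t; exact: nbhs_pinfty_ge.
apply: (@le_trans _ _ (Num.max M 0)); first by rewrite le_max lexx.
have m0 : 0 <= Num.max M 0 by rewrite le_max lexx orbT.
have : ((Num.max M 0) `^ p^-1) `^ p <= t `^ p.
  by apply: ge0_ler_powR; rewrite ?nnegrE ?powR_ge0// ?ltW// (le_trans _ t0) ?powR_ge0.
by rewrite -powRrM mulVf ?gt_eqF// powRr1.
Unshelve. all: by end_near. Qed.

Lemma right_limit_window {R : realType} (F : R -> R) (c nu kappa : R) : 0 < kappa ->
  F p / (p - c) `^ (nu + 1) @[p --> c^'+] --> kappa ->
  exists2 r, 0 < r & forall e, 0 < e -> e < r ->
    kappa / 2 * e `^ (nu + 1) <= F (c + e) <= 2 * kappa * e `^ (nu + 1).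
Proof.
move=> k0 /cvgrPdist_lt /(_ (kappa / 2)); rewrite divr_gt0// => /(_ isT) [r /= r0 H].
exists r => // e e0 er; have := H (c + e); rewrite /= ltrDl e0.
have -> : c - (c + e) = - e by ring.
rewrite normrN gtr0_norm// er => /(_ isT isT); rewrite addrAC subrr add0r.
have ep : 0 < e `^ (nu + 1) by exact: powR_gt0.
rewrite ltr_norml => /andP[h1 h2]; apply/andP; split.
  by rewrite -ler_pdivlMr//; lra.
by rewrite -ler_pdivrMr//; lra.
Qed.

Theorem theorem4 (R : realType) (d : measure_display) (T : measurableType d)
    (P : probability T R) (c nu kappa : R)
    (F : cumulativeBounded (0 : R) (1 : R))
    (rate : nat -> {RV P >-> R}) (clock : nat -> R -> {RV P >-> nat}) :
  0 < c ->
  (forall p, p < c -> F p = 0) -> F c = 0 ->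
  (forall p, c < p -> 0 < F p) -> F 1 = 1 ->
  iid_with_df F rate ->
  poisson_clocks rate clock ->
  -1 < nu -> nu < 0 -> 0 < kappa ->
  F p / (p - c) `^ (nu + 1) @[p --> c^'+] --> kappa ->
  forall eps : R, 0 < eps ->
  (exists2 b0 : R, 0 < b0 & forall b : R, b0 <= b ->
     \forall t \near +oo,
       ((1 - eps)%:E <=
        P [set w | beyond c (fun k s => clock k s w) t
                   <= (b * t `^ ((1 + nu) / 2))%:E])%E)
  /\
  (exists2 a0 : R, 0 < a0 & forall a : R, 0 < a -> a <= a0 ->
     \forall t \near +oo,
       ((1 - eps)%:E <=
        P [set w | (a * t `^ ((1 + nu) / (3 + nu)))%:E
                   <= beyond c (fun k s => clock k s w) t])%E).
Proof.
move=> c0 _ Fc _ _ iid clocks nu1 nu0 kappa0 limF eps eps0.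
have [r r0 Fr] := right_limit_window kappa0 limF.
have nu10 : 0 < nu + 1 by lra.
split.
(* Poisson parameters up to c t + sqrt t are of the form x + K sqrt x with x = c t and K = 1 / sqrt
   c. *)
- have [de /andP[de0 de1] tail] := poisson_lower_tail (divr_ge0 ler01 (sqrtr_ge0 c)).
  (* Chosen so that de kappa (b - 1) / 2 >= 1 / eps, after which exp(-1 / eps) <= eps. The 1 absorbs
     the truncation in [n], as [u >= 1]. *)
  exists (1 + 2 / (de * kappa * eps)).
    by rewrite addr_gt0// divr_gt0// !mulr_gt0.
  move=> b b_ge.
  have b0 : 0 < b.
    by apply: (lt_le_trans _ b_ge); rewrite addr_gt0// divr_gt0// !mulr_gt0.
  near=> t.
  have t1 : 1 <= t by near: t; exact: nbhs_pinfty_ge.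
  have t0 : 0 < t by lra.
  have ct : 64 <= c * t.
    by rewrite mulrC -ler_pdivrMr//; near: t; exact: nbhs_pinfty_ge.
  pose u := t `^ ((1 + nu) / 2).
  have u1 : 1 <= u by rewrite /u; near: t; apply: near_powR_ge; lra.
  have u0 : 0 < u by lra.
  pose eta := (t `^ (1 / 2))^-1.
  have tr : 2 / r <= t `^ (1 / 2) by near: t; apply: near_powR_ge; lra.
  have th0 : 0 < t `^ (1 / 2) by exact: powR_gt0.
  have eta0 : 0 < eta by rewrite invr_gt0.
  have etar : eta < r.
    rewrite invf_plt ?posrE//; apply: lt_le_trans tr.
    by rewrite -[ltLHS]mul1r ltr_pM2r ?invr_gt0//; lra.
  have eta_t : eta * t = Num.sqrt t.
    have tt : t = t `^ (1 / 2) * t `^ (1 / 2).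
      rewrite -powRD; last by rewrite (gt_eqF t0) implybT.
      by rewrite -[LHS](powRr1 (ltW t0)); congr (_ `^ _); lra.
    by rewrite -powR12_sqrt ?(ltW t0)// [in LHS]tt /eta mulKf ?gt_eqF// div1r.
  have eta_u : eta `^ (nu + 1) = u^-1.
    rewrite /eta -powRN -powRrM -powRN; congr (_ `^ _); lra.
  pose n := Num.truncn (b * u).
  have bu0 : 0 <= b * u by rewrite mulr_ge0 ?ltW.
  have n_le : n%:R <= b * u by rewrite truncn_le.
  have n_ge : b * u - 1 <= n%:R by have := truncnS_gt (b * u); rewrite -natr1 -/n; lra.
  have /andP[q_ge _] := Fr eta eta0 etar; rewrite eta_u in q_ge.
  set q := F (c + eta) in q_ge.
  have q0 : 0 <= q by rewrite (df_ge0 iid).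
  have q1 : q <= 1 by rewrite (df_le1 iid).
  apply: (prob_beyond_le clocks (ltW t0) bu0 n_le).
  have de01 : 0 <= de <= 1 by rewrite (ltW de0) (ltW de1).
  apply: le_trans (prob_all_clocks_gt iid clocks (x := c + eta) n Fc c0 t0 de01 _) _.
    move=> p cp pc; apply: tail => //; first by rewrite ler_wpM2r ?(ltW t0)// ltW.
    apply: (@le_trans _ _ ((c + eta) * t)); first by rewrite ler_wpM2r ?(ltW t0).
    rewrite mulrDl eta_t sqrtrM ?(ltW c0)// lerD2l div1r mulKf//.
    by rewrite gt_eqF// sqrtr_gt0.
  rewrite lee_fin -/q.
  have nq : kappa / 2 * (b - 1) <= q * n%:R.
    apply: (@le_trans _ _ (kappa / 2 * u^-1 * (b * u - 1))).
      rewrite (_ : kappa / 2 * u^-1 * (b * u - 1) = kappa / 2 * (b - u^-1)); last first.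
        by field; rewrite gt_eqF.
      have : u^-1 <= 1 by rewrite invf_le1.
      by move=> ui; apply: ler_wpM2l; lra.
    have ku0 : 0 <= kappa / 2 * u^-1 by rewrite mulr_ge0 ?divr_ge0 ?invr_ge0 ?(ltW u0) ?(ltW kappa0).
    have [le0|gt0] := leP (b * u - 1) 0.
      apply: (@le_trans _ _ 0); last exact: mulr_ge0.
      exact: mulr_ge0_le0.
    by apply: ler_pM => //; exact: ltW.
  apply: (@le_trans _ _ (expR (- (de * (q * n%:R))))).
    rewrite (_ : - (de * (q * n%:R)) = - (de * q) * n%:R); last by ring.
    rewrite expRM_natr lerXn2r ?nnegrE ?expR_ge0 ?expR_ge1Dx//.
    by rewrite subr_ge0 mulr_ile1 ?(ltW de0) ?(ltW de1).
  apply: (@le_trans _ _ (expR (- (1 / eps)))).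
    rewrite ler_expR lerN2; apply: (@le_trans _ _ (de * (kappa / 2 * (b - 1)))).
      have : 2 / (de * kappa * eps) <= b - 1 by lra.
      rewrite ler_pdivrMr ?mulr_gt0// => h.
      by rewrite ler_pdivrMr//; lra.
    by apply: ler_wpM2l => //; exact: ltW.
  by apply: le_trans (expRN_le_div ltr01 eps0) _; rewrite divr1.
- pose K1 := 2 * kappa + 48 * c; pose K2 := 2 * kappa + 1200 * c.
  have K10 : 0 < K1 by rewrite addr_gt0 ?mulr_gt0 ?ltr0n.
  have K20 : 0 < K2 by rewrite addr_gt0 ?mulr_gt0 ?ltr0n.
  (* [K1 a] takes half of [eps]; the other half is left to [K2 / s], which vanishes for large
     [t]. *)
  exists (eps / 2 / K1); first by rewrite !divr_gt0.
  have nu30 : 0 < 3 + nu by lra.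
  move=> a a0 a_le; near=> t.
  have t1 : 1 <= t by near: t; exact: nbhs_pinfty_ge.
  have t0 : 0 < t by lra.
  pose v := t `^ (3 + nu)^-1; pose eta := v^-1.
  (* The four thresholds serve, in turn, [eta <= 1], [eta <= c], [8 a eta <= 1] and [eta < r]. *)
  have v_ge M : M \in [:: 1; c^-1; 8 * a; 2 / r] -> M <= v.
    rewrite !inE => /or4P[] /eqP ->; rewrite /v; near: t; apply: near_powR_ge; by rewrite invr_gt0.
  have v1 : 1 <= v by apply: v_ge; rewrite mem_head.
  have v0 : 0 < v by lra.
  have eta0 : 0 < eta by rewrite invr_gt0.
  have eta1 : eta <= 1 by rewrite invf_le1.
  pose s := t `^ ((1 + nu) / (3 + nu)).
  have s8 : 8 <= s by rewrite /s; near: t; apply: near_powR_ge; rewrite divr_gt0//; lra.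
  have sK : 2 * K2 / eps <= s by rewrite /s; near: t; apply: near_powR_ge; rewrite divr_gt0//; lra.
  have s0 : 0 < s by lra.
  have sE : eta ^+ 2 * t = s.
    rewrite /eta /v -powRN -powR_mulrn ?powR_ge0// -powRrM -{2}(powRr1 (ltW t0)).
    rewrite -powRD; last by rewrite (gt_eqF t0) implybT.
    by rewrite /s; congr (_ `^ _); field; rewrite gt_eqF.
  have eta_s : eta `^ (nu + 1) = s^-1.
    by rewrite /eta /v /s -!powRN -powRrM; congr (_ `^ _); field; rewrite gt_eqF.
  have etar : eta < r.
    have : 2 / r <= v by apply: v_ge; rewrite !inE eqxx !orbT.
    rewrite invf_plt ?posrE//; apply: lt_le_trans.
    by rewrite -[ltLHS]mul1r ltr_pM2r ?invr_gt0//; lra.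
  have /andP[_ F_le] := Fr eta eta0 etar; rewrite eta_s -{1}sE in F_le.
  have slow : (P [set w | ((xi (fun k s => clock k s w)
      (Num.truncn (a * (eta ^+ 2 * t))).+1.-1 t)%:~R <= c * t)%R] <=
      (K1 * a + K2 / (eta ^+ 2 * t))%:E)%E.
    apply: (prob_slow_particle iid clocks) => //.
    - by rewrite invf_ple ?posrE//; apply: v_ge; rewrite !inE eqxx !orbT.
    - rewrite mulrA ler_pdivrMr// mul1r; apply: v_ge; by rewrite !inE eqxx !orbT.
    - rewrite (le_trans s8)// -sE expr2 -mulrA ler_piMl//; exact/ltW/mulr_gt0.
  rewrite sE in slow.
  apply: (prob_le_beyond clocks (ltW t0) (ltW (truncnS_gt (a * s))) isT).
  apply: le_trans slow _; rewrite lee_fin.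
  have : K1 * a <= eps / 2 by rewrite mulrC -ler_pdivlMr.
  have : K2 / s <= eps / 2.
    rewrite ler_pdivrMr//; move: sK; rewrite ler_pdivrMr//; lra.
  lra.
Unshelve. all: by end_near. Qed.
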